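(* Let $N\ge2$ be an even integer, and let $P^{even}_{\max}$ denote the (unique) polynomial in $\mathcal T_N$ whose coefficient $a_2$ is maximal among all polynomials in $\mathcal T_N$. Then $P^{even}_{\max}(z)=P_1^e(z)+P_2^e(z)$, where $$P^e_1(z)=\frac{z+z^5+\gamma_1(z^2+z^4)+\gamma_2z^3}{(1+z)^2(z^2+1-2\eta_Nz)^2},$$ $$\eta_N=1-2\nu_N^2,\qquad \gamma_1=2(1-\eta_N),\qquad \gamma_2=\frac2{N+3}\left(-2\eta_N^2-2(N+3)\eta_N+N+5\right),$$ $$P^e_2(z)=Q_N\frac{2^3z^4}{(1-z)(1+z)^3(z^2+1-2\eta_Nz)^2}\left(\left(\frac{N+4}2\right)^2(1-z^{N+2})+\left(\frac{N+2}2\right)^2(1-z^{N+4})+\frac{(N+2)(N+4)}2(z-z^{N+3})\right),$$ $$Q_N=\frac{2(1-\eta_N^2)}{(N+2)(N+3)(N+4)}.$$ For the problem of minimizing $a_2$ over $\mathcal T_N$, the extremizer is obtained from the extremizer of the maximum problem by changing the signs of the coefficients of even powers. The resulting non-negative trigonometric polynomial (for $t\in(0,\pi)$) has the form $$\mathrm{Im}\left(P^{even}_{\max}(e^{it})\right)=Q_N\,\frac1{1+\cos t}\cdot\frac1{\sin t}\cdot\frac{\left(\frac{N+4}2\sin\frac{N+2}2t+\frac{N+2}2\sin\frac{N+4}2t\right)^2}{(\cos t-\eta_N)^2}.$$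
   Context: $\mathbb D=\{z\in\mathbb C:|z|<1\}$. A holomorphic function $F:\mathbb D\to\mathbb C$ is typically real if $F(z)\in\mathbb R$ for all $z\in\mathbb R\cap\mathbb D$ and $\mathrm{Im}\{F(z)\}\cdot\mathrm{Im}\{z\}>0$ for all $z\in\mathbb D\setminus\mathbb R$. $\mathcal T_N$ is the set of typically real polynomials of the form $P(z)=z+\sum_{j=2}^Na_jz^j$ with $a_j\in\mathbb R$. $U_j$ ($j\ge0$) is the Chebyshev polynomial of the second kind, $U_j(\cos t)=\sin((j+1)t)/\sin t$, and $U_j'$ is its derivative. $\nu_N$ is the smallest positive root of the equation $U'_{N+2}(x)=0$. The right-hand sides are understood after removal of removable singularities. *)

(* Defs.v *)
From mathcomp Require Import all_boot all_order all_algebra.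
From mathcomp Require Import all_classical all_reals all_analysis.
From mathcomp Require Import complex.
From mathcomp Require Import ring lra.
Set Implicit Arguments.
Unset Strict Implicit.
Unset Printing Implicit Defensive.
Import Order.TTheory GRing.Theory Num.Theory numFieldNormedType.Exports.
Local Open Scope classical_set_scope.
Local Open Scope ring_scope.

Section TypicallyReal.
Variable R : realType.
Local Notation C := R[i].

(* Derivability along the vector 1 of the one-dimensional complex space C^o is
   complex differentiability. *)
Definition holomorphic_on_disk (F : C -> C) :=
  forall z : C, `|z| < 1 -> derivable (F : C^o -> C^o) z 1.

(* Only the values of F on the open unit disk matter. *)
Definition typically_real (F : C -> C) :=
  [/\ holomorphic_on_disk F,
      (forall z : C, `|z| < 1 -> complex.Im z = 0 -> complex.Im (F z) = 0) &
      (forall z : C, `|z| < 1 -> complex.Im z != 0 ->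
         0 < complex.Im (F z) * complex.Im z)].

Definition evalC (P : {poly R}) (z : C) : C :=
  (map_poly (real_complex R) P).[z].

Definition typically_real_poly (N : nat) (P : {poly R}) :=
  [/\ (size P <= N.+1)%N, P`_0 = 0, P`_1 = 1 & typically_real (evalC P)].

Definition maximizes_a2 (N : nat) (P : {poly R}) :=
  typically_real_poly N P /\
  forall S, typically_real_poly N S -> S`_2 <= P`_2.

Definition minimizes_a2 (N : nat) (P : {poly R}) :=
  typically_real_poly N P /\
  forall S, typically_real_poly N S -> P`_2 <= S`_2.

Definition flip_even (P : {poly R}) : {poly R} :=
  \poly_(j < size P) (if odd j then P`_j else - P`_j).

Definition expi (t : R) : C := (cos t +i* sin t)%C.

End TypicallyReal.

Section Chebyshev.
Variable R : realType.

Fixpoint chebU (n : nat) : {poly R} :=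
  match n with
  | 0 => 1
  | 1 => 2%:P * 'X
  | (m.+1 as k).+1 => 2%:P * 'X * chebU k - chebU m
  end.

Lemma chebU_cos (n : nat) (t : R) : sin t != 0 ->
  (chebU n).[cos t] = sin (n.+1%:R * t) / sin t.
Proof.
move=> st.
suff H k : (chebU k).[cos t] * sin t = sin (k.+1%:R * t) /\
           (chebU k.+1).[cos t] * sin t = sin (k.+2%:R * t).
  by have [<- _] := H n; rewrite mulfK.
elim: k => [|k [IH1 IH2]]; last split=> //.
  split; first by rewrite /= hornerE !mul1r.
  have -> : 2%:R * t = t + t by ring.
  by rewrite /= !hornerE sinD; ring.
have -> : (chebU k.+2).[cos t] =
    2 * cos t * (chebU k.+1).[cos t] - (chebU k).[cos t].
  by rewrite [chebU k.+2]/= -/(chebU k.+1) !hornerE.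
rewrite mulrBl -(mulrA (2 * cos t)) IH1 IH2.
have -> : k.+3%:R * t = k.+2%:R * t + t by rewrite -[k.+3%:R]natr1; ring.
have -> : k.+1%:R * t = k.+2%:R * t - t by rewrite -[k.+2%:R]natr1; ring.
rewrite sinB sinD; ring.
Qed.

Definition smallest_pos_root (p : {poly R}) (x : R) :=
  [/\ 0 < x, root p x & forall y, 0 < y -> root p y -> x <= y].

Definition is_nu (N : nat) (nu : R) :=
  smallest_pos_root ((chebU (N + 2))^`()) nu.

End Chebyshev.

(* On D, f is g after removal of the singularities of g, which lie in sing
   (on sing, g itself takes meaningless values since x / 0 = 0). *)
Definition eq_after_removal (K : numFieldType) (D sing : set K) (f g : K -> K) :=
  (forall x : K, D x -> ~ sing x -> f x = g x) /\
  (forall x : K, D x -> sing x ->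
     (g : K^o -> K^o) y @[y --> (x : K^o)^'] --> (f x : K^o)).

Section Extremizer.
Variable R : realType.
Local Notation C := R[i].

Definition eta_ (nu : R) : R := 1 - 2 * nu ^+ 2.

Definition gamma1 (eta : R) : R := 2 * (1 - eta).

Definition gamma2 (N : nat) (eta : R) : R :=
  2 / (N%:R + 3) * (- 2 * eta ^+ 2 - 2 * (N%:R + 3) * eta + N%:R + 5).

Definition Q_ (N : nat) (eta : R) : R :=
  2 * (1 - eta ^+ 2) / ((N%:R + 2) * (N%:R + 3) * (N%:R + 4)).

Definition P1e (N : nat) (eta : R) (z : C) : C :=
  (z + z ^+ 5 + (gamma1 eta)%:C%C * (z ^+ 2 + z ^+ 4)
     + (gamma2 N eta)%:C%C * z ^+ 3)
  / ((1 + z) ^+ 2 * (z ^+ 2 + 1 - 2 * eta%:C%C * z) ^+ 2).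

Definition P2e (N : nat) (eta : R) (z : C) : C :=
  (Q_ N eta)%:C%C
  * (2 ^+ 3 * z ^+ 4
     / ((1 - z) * (1 + z) ^+ 3 * (z ^+ 2 + 1 - 2 * eta%:C%C * z) ^+ 2))
  * (((N%:R + 4) / 2) ^+ 2 * (1 - z ^+ (N + 2))
     + ((N%:R + 2) / 2) ^+ 2 * (1 - z ^+ (N + 4))
     + (N%:R + 2) * (N%:R + 4) / 2 * (z - z ^+ (N + 3))).

Definition sing_z (eta : R) : set C :=
  [set z | (1 - z) * (1 + z) * (z ^+ 2 + 1 - 2 * eta%:C%C * z) = 0].

Definition trig_rhs (N : nat) (eta : R) (t : R) : R :=
  Q_ N eta * (1 / (1 + cos t)) * (1 / sin t)
  * (((N%:R + 4) / 2 * sin ((N%:R + 2) / 2 * t)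
      + (N%:R + 2) / 2 * sin ((N%:R + 4) / 2 * t)) ^+ 2
     / (cos t - eta) ^+ 2).

Definition sing_t (eta : R) : set R := [set t | cos t = eta].

End Extremizer.

(* Main.v *)
Require Import Defs.
From mathcomp Require Import all_boot all_order all_algebra.
From mathcomp Require Import all_classical all_reals all_analysis.
From mathcomp Require Import complex.
From mathcomp Require Import ring lra zify.
Import Order.TTheory GRing.Theory Num.Theory numFieldNormedType.Exports.
Local Open Scope classical_set_scope.
Local Open Scope ring_scope.

(** Write N = 2 m. On the unit circle Im P (exp (i t)) = sin t q (cos t), where
    q = P_1 S_1 + ... + P_N S_N and S_j is the polynomial with
    S_j (cos t) = sin (j t) / sin t. By the minimum principle for the harmonic
    function Im P on the upper half disk, P is typically real exactly when
    q >= 0 on [-1, 1] ([typically_real_polyP]). Maximizing a_2 is therefore a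
    linear problem over the non-negative polynomials q of degree below 2 m:
    for the weight sqrt (1 - x ^ 2), a_1 is the normalized integral of q and
    a_2 that of 2 x q.

    It is solved by a Gauss-Radau quadrature whose nodes are -1 and the zeros of
    the orthogonal polynomial of degree m for (1 + x) sqrt (1 - x ^ 2). These are
    the m + 1 roots of G = (m + 2) S_(m+1) + (m + 1) S_(m+2), and everything
    about G is explicit: the zeros are located by sign changes, and the weights
    are positive because of a closed formula for them ([weight_gt0]). No integral
    is needed: that the quadrature reproduces a_1 and a_2 is an identity between
    divided sums ([quadrature_chebS]). If eta is the largest node, the quadrature
    applied to 2 (eta - x) q reads 2 eta a_1 - a_2 = sum of non-negative terms,
    so a_2 <= 2 eta; equality forces q to vanish at all the other nodes, doubly
    at the interior ones, which leaves only
    q (1 + x) (x - eta) ^ 2 = Q G ^ 2 ([extremal_of_coef2]). The half-angle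
    substitution x = 1 - 2 y ^ 2 turns the roots of G into those of U'_(N+2), so
    that eta = 1 - 2 nu ^ 2 ([is_nu_largest_node]).

    The trigonometric form is this identity at x = cos t. For the form in z,
    multiply P by the common denominator of the claimed expression. Since
    P (x) - P (1 / x) = (x - 1 / x) q ((x + 1 / x) / 2), the difference F of the two
    sides satisfies F (x) + x ^ 8 F (1 / x) = 0. This kills all coefficients above
    the eighth and makes the remaining ones antisymmetric; a_1 = 1, a_2 = 2 eta
    and the multiple zero of the denominator at -1 then give F = 0
    ([denom_poly_mul_extremal]). *)

Set Implicit Arguments.
Unset Strict Implicit.
Unset Printing Implicit Defensive.

(** * Chebyshev polynomials of the second kind *)

Section ChebyshevAlgebra.
Variable R : realType.
Implicit Types (x y : R) (n m k j : nat).

(** The index is shifted so that [chebS n] is sin (n t) / sin t in the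
    variable cos t: the three-term recurrence then starts at 0, and the
    degrees match the coefficients of a sine polynomial. *)
Definition chebS n : {poly R} := if n is k.+1 then chebU R k else 0.

Lemma chebSS n : chebS n.+2 = 2%:P * 'X * chebS n.+1 - chebS n.
Proof. by case: n => [|n] //=; rewrite subr0 mulr1. Qed.

Lemma horner_chebSS n x :
  (chebS n.+2).[x] = 2 * x * (chebS n.+1).[x] - (chebS n).[x].
Proof. by rewrite chebSS !hornerE. Qed.

Lemma chebS_ind2 (P : nat -> Prop) :
  P 0%N -> P 1%N -> (forall n, P n -> P n.+1 -> P n.+2) -> forall n, P n.
Proof.
move=> P0 P1 PS n; suff [] : P n /\ P n.+1 by [].
by elim: n => [|n [IH1 IH2]]; split=> //; apply: PS.
Qed.

Lemma size_chebS_le n : (size (chebS n) <= n)%N.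
Proof.
elim/chebS_ind2: n => [||n IH1 IH2]; rewrite ?size_poly0 ?size_poly1 //.
rewrite chebSS (leq_trans (size_polyD _ _)) // geq_max size_polyN; apply/andP; split.
  rewrite -mulrA mul_polyC (leq_trans (size_scale_leq _ _)) // -commr_polyX.
  by rewrite (leq_trans (size_polyMleq _ _)) // size_polyX addn2 /= ltnS.
by rewrite (leq_trans IH1) // ltnW.
Qed.

Lemma coef_chebS_lead n : (chebS n.+1)`_n = 2 ^+ n.
Proof.
elim: n => [|n IH]; first by rewrite coef1.
rewrite chebSS coefB -mulrA mul_polyC coefZ coefXM /= IH -exprS.
by rewrite [X in _ - X]nth_default ?subr0 // (leq_trans (size_chebS_le _)) // leqnSn.
Qed.

(** The identity sin (a + t) sin b - sin a sin (b + t) = sin t sin (b - a): the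
    determinant is, up to sign, the polynomial indexed by the distance of the
    two indices. *)
Lemma size_chebS_det j n :
  (size (chebS j.+1 * chebS n - chebS j * chebS n.+1)%R <= maxn (n - j) (j - n))%N.
Proof.
elim: j n => [|j IH] [|n]; rewrite ?mulr0 ?mul0r ?subrr ?size_poly0 //.
- by rewrite mul1r subr0 subn0 sub0n maxn0 size_chebS_le.
- by rewrite sub0r size_polyN mulr1 subn0 sub0n max0n size_chebS_le.
have -> : chebS j.+2 * chebS n.+1 - chebS j.+1 * chebS n.+2 =
          chebS j.+1 * chebS n - chebS j * chebS n.+1.
  by rewrite !chebSS; ring.
by rewrite !subSS IH.
Qed.

Lemma chebS_pythagoras n x :
  (chebS n).[x] ^+ 2 + (chebS n.+1).[x] ^+ 2
    - 2 * x * (chebS n).[x] * (chebS n.+1).[x] = 1.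
Proof.
elim: n => [|n IH]; first by rewrite /= !hornerE; ring.
by rewrite -[RHS]IH horner_chebSS; ring.
Qed.

(** With x = exp (i t) this is the definition of [chebS]; a real x <> 0 makes
    the same identity available without complex numbers. *)
Lemma chebS_joukowski n x : x != 0 ->
  (chebS n).[(x + x^-1) / 2] * (x - x^-1) = x ^+ n - x ^- n.
Proof.
move=> x0; elim/chebS_ind2: n => [||n IH1 IH2].
- by rewrite horner0 mul0r invr1 subrr.
- by rewrite hornerE mul1r !expr1.
rewrite horner_chebSS mulrBl IH1 -(mulrA (2 * _)) IH2 -!exprVn !exprS.
have := mulfV x0; move: (x^-1) => y xy.
have -> : 2 * ((x + y) / 2) = x + y by field.
have -> : (x + y) * (x * x ^+ n - y * y ^+ n) - (x ^+ n - y ^+ n) =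
  x * (x * x ^+ n) - y * (y * y ^+ n) + (x * y - 1) * (x ^+ n - y ^+ n) by ring.
by rewrite xy subrr mul0r addr0.
Qed.

Lemma chebS_opp n x : (chebS n).[- x] = (-1) ^+ n.+1 * (chebS n).[x].
Proof.
elim/chebS_ind2: n => [||n IH1 IH2]; rewrite ?horner0 ?mulr0 ?hornerE //.
  by rewrite /=; ring.
by rewrite !horner_chebSS IH1 IH2 !exprS; ring.
Qed.

(** sin (2 k t) / sin t = 2 cos t (sin (k (2 t)) / sin (2 t)). *)
Lemma chebS_double k y :
  (chebS k.*2).[y] = 2 * y * (chebS k).[2 * y ^+ 2 - 1].
Proof.
elim/chebS_ind2: k => [||k IH1 IH2]; first by rewrite /= !hornerE; ring.
  by rewrite /= !hornerE.
rewrite horner_chebSS mulrBr -IH1 mulrCA -IH2 !doubleS !horner_chebSS; ring.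
Qed.

Lemma chebS_deriv n x :
  (1 - x ^+ 2) * ((chebS n)^`()).[x] =
  (n%:R + 1) * x * (chebS n).[x] - n%:R * (chebS n.+1).[x].
Proof.
elim/chebS_ind2: n => [||n IH1 IH2].
- by rewrite /= linear0 !hornerE; ring.
- by rewrite /= derivC !hornerE; ring.
have -> : ((chebS n.+2)^`()).[x] = 2 * (chebS n.+1).[x]
    + 2 * x * ((chebS n.+1)^`()).[x] - ((chebS n)^`()).[x].
  by rewrite chebSS !poly.derivE !hornerE; ring.
rewrite mulrBr mulrDr IH1 [_ * (2 * x * _)]mulrCA IH2 !horner_chebSS.
rewrite -[n.+2%:R]natr1 -[n.+1%:R]natr1.
ring.
Qed.

Lemma chebS_at_N1 n : (chebS n).[-1] = - (-1) ^+ n * n%:R.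
Proof.
elim/chebS_ind2: n => [||n IH1 IH2]; rewrite ?horner0 ?mulr0 ?hornerE //.
  by rewrite /=; ring.
rewrite horner_chebSS IH1 IH2 -[n.+2%:R]natr1 -[n.+1%:R]natr1 !exprS; ring.
Qed.

Lemma chebS_deriv_at_N1 n :
  3 * ((chebS n)^`()).[-1] = (-1) ^+ n * (n%:R - 1) * n%:R * (n%:R + 1).
Proof.
elim/chebS_ind2: n => [||n IH1 IH2].
- by rewrite /= linear0 !hornerE; ring.
- by rewrite /= derivC !hornerE; ring.
have -> : ((chebS n.+2)^`()).[-1] = 2 * (chebS n.+1).[-1]
    + 2 * (-1) * ((chebS n.+1)^`()).[-1] - ((chebS n)^`()).[-1].
  by rewrite chebSS !poly.derivE !hornerE; ring.
rewrite mulrBr IH1 mulrDr [3 * (2 * (-1) * _)]mulrCA IH2 chebS_at_N1.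
rewrite -[n.+2%:R]natr1 -[n.+1%:R]natr1 !exprS; ring.
Qed.

Lemma chebS_cos n (t : R) : sin t * (chebS n).[cos t] = sin (n%:R * t).
Proof.
elim/chebS_ind2: n => [||n IH1 IH2].
- by rewrite horner0 mulr0 mul0r sin0.
- by rewrite hornerE mulr1 mul1r.
rewrite horner_chebSS mulrBr IH1 mulrCA IH2.
have -> : n.+2%:R * t = n.+1%:R * t + t by rewrite -[n.+2%:R]natr1; ring.
have -> : n%:R * t = n.+1%:R * t - t by rewrite -[n.+1%:R]natr1; ring.
rewrite sinB sinD; ring.
Qed.

(** In the variable cos t, the sine polynomial sum P_j sin (j t) over sin t. *)
Definition sin_quotient (P : {poly R}) : {poly R} :=
  \sum_(j < size P) P`_j *: chebS j.

Lemma sin_quotientE n (P : {poly R}) : (size P <= n)%N ->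
  sin_quotient P = \sum_(j < n) P`_j *: chebS j.
Proof.
move=> sP; rewrite /sin_quotient (big_ord_widen n (fun j => P`_j *: chebS j)) //.
rewrite big_mkcond; apply: eq_bigr => j _; case: ltnP => // jP.
by rewrite nth_default // scale0r.
Qed.

Lemma horner_sin_quotient n (P : {poly R}) x : (size P <= n)%N ->
  (sin_quotient P).[x] = \sum_(j < n) P`_j * (chebS j).[x].
Proof.
by move=> /sin_quotientE ->; rewrite horner_sum; apply: eq_bigr => j _; rewrite hornerZ.
Qed.

Lemma sin_quotientD (P Q : {poly R}) :
  sin_quotient (P + Q) = sin_quotient P + sin_quotient Q.
Proof.
pose n := maxn (size P) (size Q).
have sP : (size P <= n)%N by rewrite leq_maxl.
have sQ : (size Q <= n)%N by rewrite leq_maxr.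
rewrite (sin_quotientE sP) (sin_quotientE sQ) (sin_quotientE (size_polyD P Q)).
rewrite -big_split /=.
by apply: eq_bigr => j _; rewrite coefD scalerDl.
Qed.

Lemma size_sin_quotient n (P : {poly R}) : (size P <= n.+1)%N ->
  (size (sin_quotient P) <= n)%N.
Proof.
move=> sP; rewrite /sin_quotient.
apply: (big_ind (fun p : {poly R} => (size p <= n)%N)).
- by rewrite size_poly0.
- by move=> p q sp sq; rewrite (leq_trans (size_polyD _ _)) // geq_max sp.
move=> [j jP] _; rewrite (leq_trans (size_scale_leq _ _)) //.
by rewrite (leq_trans (size_chebS_le _)) // -ltnS (leq_trans jP).
Qed.

(** S_1, ..., S_n have degrees 0, ..., n - 1, hence form a basis. *)
Lemma sin_quotient_onto n (q : {poly R}) : (size q <= n)%N ->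
  exists P : {poly R}, [/\ (size P <= n.+1)%N, P`_0 = 0 & sin_quotient P = q].
Proof.
elim: n q => [|n IH] q sq.
  exists 0; rewrite size_poly0 coef0; split=> //.
  by rewrite /sin_quotient size_poly0 big_ord0; apply/esym/eqP; rewrite -size_poly_leq0.
pose c := q`_n / 2 ^+ n.
have [|P [sP P0 qP]] := IH (q - c *: chebS n.+1).
  apply/leq_sizeP => k; rewrite leq_eqVlt => /predU1P[<- | nk].
    by rewrite coefB coefZ coef_chebS_lead divfK ?subrr // expf_neq0 ?pnatr_eq0.
  by rewrite coefB coefZ !nth_default ?mulr0 ?subr0 ?(leq_trans (size_chebS_le _)) ?(leq_trans sq).
have sX : (size (c *: 'X^(n.+1))%R <= n.+2)%N.
  by rewrite (leq_trans (size_scale_leq _ _)) // size_polyXn.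
exists (P + c *: 'X^(n.+1)); split.
- by rewrite (leq_trans (size_polyD _ _)) // geq_max sX andbT (leq_trans sP).
- by rewrite coefD coefZ coefXn P0 mulr0 addr0.
rewrite sin_quotientD qP (sin_quotientE sX) (bigD1 ord_max) //= coefZ coefXn eqxx.
rewrite mulr1 big1 ?addr0 ?subrK // => j /negPf jn.
by rewrite coefZ coefXn -[n.+1]/(nat_of_ord (@ord_max n.+1)) val_eqE jn mulr0 scale0r.
Qed.

Lemma sin_quotient_inj (P S : {poly R}) : P`_0 = S`_0 ->
  sin_quotient P = sin_quotient S -> P = S.
Proof.
move=> e0 e; apply/eqP; rewrite -subr_eq0; apply/eqP.
have D0 : (P - S)`_0 = 0 by rewrite coefB e0 subrr.
have : sin_quotient (P - S) = 0.
  by apply: (addIr (sin_quotient S)); rewrite -sin_quotientD subrK add0r e.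
move: (P - S) D0 => D D0 qD; case def: (size D) => [|[|k]].
- by apply/eqP; rewrite -size_poly_eq0 def.
- by rewrite (size1_polyC (eq_leq def)) D0.
have : (sin_quotient D)`_k = D`_k.+1 * 2 ^+ k.
  rewrite (sin_quotientE (eq_leq def)) coef_sum big_ord_recr coefZ coef_chebS_lead.
  rewrite big1 => [|j _]; first exact: add0r.
  rewrite coefZ [X in _ * X]nth_default ?mulr0 //.
  by apply: leq_trans (size_chebS_le _) _; rewrite -ltnS; exact: (ltn_ord j).
rewrite qD coef0 => /esym/eqP; rewrite mulf_eq0 expf_eq0 pnatr_eq0 andbF orbF.
by move=> Dk; apply/eqP; rewrite -lead_coef_eq0 lead_coefE def.
Qed.

End ChebyshevAlgebra.

(** * A quadrature formula at the roots of a combination of Chebyshev polynomials *)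

(** Lagrange interpolation at the simple roots of [g], read off at the top
    coefficient. *)
Lemma sum_lagrange_top_coef (F : fieldType) (g f : {poly F}) (rs : seq F) :
  uniq rs -> all (root g) rs -> size g = (size rs).+1 ->
  (size f <= size rs)%N ->
  \sum_(x <- rs) f.[x] / (g^`()).[x] = f`_(size rs).-1 / lead_coef g.
Proof.
move=> urs grs sg sf.
have g0 : lead_coef g != 0 by rewrite lead_coef_eq0 -size_poly_eq0 sg.
have gE := all_roots_prod_XsubC sg grs (etrans (uniq_rootsE rs) urs).
pose l x := lead_coef g *: \prod_(z <- rem x rs) ('X - z%:P).
have glE x : x \in rs -> g = l x * ('X - x%:P).
  by move=> xrs; rewrite {1}gE (perm_big _ (perm_to_rem xrs)) big_cons -scalerAl mulrC.
have dg x : x \in rs -> (g^`()).[x] = (l x).[x].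
  move=> xrs; rewrite {1}(glE x xrs) derivM derivXsubC mulr1 !hornerE.
  by rewrite subrr mulr0 add0r.
have lx0 x : x \in rs -> (l x).[x] != 0.
  move=> xrs; rewrite hornerZ mulf_neq0 // -/(root _ x) root_prod_XsubC.
  by rewrite mem_rem_uniqF.
have lxy x y : x \in rs -> y \in rs -> x != y -> (l x).[y] = 0.
  move=> xrs yrs xy; have /eqP := allP grs y yrs.
  rewrite {1}(glE x xrs) hornerM hornerXsubC => /eqP.
  by rewrite mulf_eq0 subr_eq0 [y == x]eq_sym (negPf xy) orbF => /eqP.
have sl x : x \in rs -> size (l x) = size rs.
  move=> xrs; rewrite size_scale // size_prod_XsubC size_rem // prednK //.
  by case: (rs) xrs.
pose h := \sum_(x <- rs) (f.[x] / (g^`()).[x]) *: l x.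
have fh : f = h.
  apply/eqP; rewrite -subr_eq0; apply/eqP.
  apply: (@roots_geq_poly_eq0 _ _ rs) => //.
    apply/allP => y yrs; rewrite rootE hornerD hornerN horner_sum.
    rewrite (bigD1_seq y) //= hornerZ big_seq_cond big1 ?addr0.
      by rewrite dg // divfK ?subrr // lx0.
    by move=> x /andP[xrs xy]; rewrite hornerZ lxy ?mulr0.
  rewrite (leq_trans (size_polyD _ _)) // geq_max size_polyN sf /=.
  rewrite /h big_seq; apply: (big_ind (fun p : {poly F} => (size p <= size rs)%N)).
  - by rewrite size_poly0.
  - by move=> p q sp sq; rewrite (leq_trans (size_polyD _ _)) // geq_max sp.
  - by move=> x xrs; rewrite (leq_trans (size_scale_leq _ _)) // sl.
rewrite [in RHS]fh coef_sum mulr_suml big_seq [RHS]big_seq.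
apply: eq_bigr => x xrs; rewrite coefZ.
suff -> : (l x)`_(size rs).-1 = lead_coef g by rewrite mulfK.
rewrite -(sl x xrs) -/(lead_coef (l x)) lead_coefZ.
by rewrite (monicP (monic_prod_XsubC _ _ _)) mulr1.
Qed.

Section Quadrature.
Variable R : realType.
Variable m : nat.
Implicit Types (x y : R) (n k j : nat) (P : {poly R}).

Local Notation chebS := (chebS R).

(** In the variable cos t, and up to the factor sin t, the function
    (m + 2) sin ((m + 1) t) + (m + 1) sin ((m + 2) t); divided by 1 + x it is
    the orthogonal polynomial of degree m for (1 + x) sqrt (1 - x ^ 2). *)
Definition node_poly : {poly R} := m.+2%:R *: chebS m.+1 + m.+1%:R *: chebS m.+2.

(** The numerator of the Christoffel weights: the associated polynomial of
    [node_poly], obtained by lowering the index. *)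
Definition assoc_poly : {poly R} :=
  2 *: (m.+2%:R *: chebS m + m.+1%:R *: chebS m.+1).

Definition weight x := assoc_poly.[x] / (node_poly^`()).[x].

Lemma horner_node_poly x :
  node_poly.[x] = m.+2%:R * (chebS m.+1).[x] + m.+1%:R * (chebS m.+2).[x].
Proof. by rewrite !hornerE. Qed.

Lemma coef_node_poly : node_poly`_m.+1 = m.+1%:R * 2 ^+ m.+1.
Proof.
rewrite coefD !coefZ coef_chebS_lead nth_default ?mulr0 ?add0r //.
by rewrite size_chebS_le.
Qed.

Lemma size_node_poly : size node_poly = m.+2.
Proof.
apply/eqP; rewrite eqn_leq; apply/andP; split; last first.
  rewrite ltnNge; apply/negP => s; move/eqP: coef_node_poly.
  by rewrite nth_default // eq_sym mulf_eq0 expf_eq0 !pnatr_eq0 andbF.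
rewrite (leq_trans (size_polyD _ _)) // geq_max.
rewrite !(leq_trans (size_scale_leq _ _)) //.
  by rewrite size_chebS_le.
by rewrite (leq_trans (size_chebS_le _ _)) // leqnSn.
Qed.

Lemma lead_coef_node_poly : lead_coef node_poly = m.+1%:R * 2 ^+ m.+1.
Proof. by rewrite lead_coefE size_node_poly coef_node_poly. Qed.

Lemma node_poly_N1 : root node_poly (-1).
Proof. by rewrite rootE horner_node_poly !chebS_at_N1 !exprS; apply/eqP; ring. Qed.

(** At a root the pair (S_(m+1), S_(m+2)) is c (m + 1, - m - 2), and the
    Pythagorean relation gives c; both factors are explicit in c. *)
Lemma assoc_poly_node_poly_deriv x : root node_poly x -> x != -1 ->
  assoc_poly.[x] * (node_poly^`()).[x] * (1 - x) =
  2 * (m%:R + 1) * (m%:R + 2) * (2 * m%:R + 3).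
Proof.
move=> /eqP Gx xN1.
have x1 : 1 + x != 0 by rewrite addrC -[1]opprK subr_eq0.
have M1 : m%:R + 1 != 0 :> R by rewrite natr1 pnatr_eq0.
apply: (mulIf x1).
have dG : (1 - x ^+ 2) * (node_poly^`()).[x] =
    m.+2%:R * ((1 - x ^+ 2) * ((chebS m.+1)^`()).[x])
    + m.+1%:R * ((1 - x ^+ 2) * ((chebS m.+2)^`()).[x]).
  by rewrite derivD !derivZ hornerD !hornerZ; ring.
have -> : assoc_poly.[x] * (node_poly^`()).[x] * (1 - x) * (1 + x) =
    assoc_poly.[x] * ((1 - x ^+ 2) * (node_poly^`()).[x]) by ring.
rewrite dG !chebS_deriv.
have -> : assoc_poly.[x] = 2 * (m.+2%:R * (chebS m).[x] + m.+1%:R * (chebS m.+1).[x]).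
  by rewrite !hornerE.
move: Gx (chebS_pythagoras m.+1 x); rewrite horner_node_poly.
have := horner_chebSS m x; have := horner_chebSS m.+1 x.
move: (chebS m).[x] (chebS m.+1).[x] (chebS m.+2).[x] (chebS m.+3).[x].
move=> s a b d ->; rewrite -[m.+2%:R]natr1 -[m.+1%:R]natr1.
move: (m%:R) M1 => M M1 bE Gx pyth.
have -> : s = 2 * x * a - b by rewrite bE; ring.
move: Gx pyth => {bE}.
have -> : a = (M + 1) * (a / (M + 1)) by field.
move: (a / (M + 1)) => c {s d}.
have -> : (M + 1 + 1) * ((M + 1) * c) + (M + 1) * b = (M + 1) * ((M + 1 + 1) * c + b).
  by ring.
move=> /eqP; rewrite mulf_eq0 (negPf M1) addrC addr_eq0 /= => /eqP -> pyth.
by rewrite -[RHS]mulr1 -[X in _ = _ * X]pyth; ring.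
Qed.

(** The computation above divides by 1 + x; at -1 the explicit values of the
    Chebyshev polynomials and of their derivatives replace it. *)
Lemma assoc_poly_node_poly_deriv_N1 :
  3 * (assoc_poly.[-1] * (node_poly^`()).[-1]) =
  2 * (m%:R + 1) * (m%:R + 2) * (2 * m%:R + 3).
Proof.
have -> : 3 * (assoc_poly.[-1] * (node_poly^`()).[-1]) = assoc_poly.[-1] *
    (m.+2%:R * (3 * ((chebS m.+1)^`()).[-1]) + m.+1%:R * (3 * ((chebS m.+2)^`()).[-1])).
  by rewrite derivD !derivZ hornerD !hornerZ; ring.
have -> : assoc_poly.[-1] = 2 * (m.+2%:R * (chebS m).[-1] + m.+1%:R * (chebS m.+1).[-1]).
  by rewrite !hornerE.
rewrite !chebS_deriv_at_N1 !chebS_at_N1 -[m.+2%:R]natr1 -[m.+1%:R]natr1 !exprS.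
have e2 : (-1) ^+ m * (-1) ^+ m = 1 :> R by rewrite -expr2 sqrr_sign.
by rewrite -[RHS]mulr1 -[X in _ = _ * X]e2; ring.
Qed.

(** The weight has the sign of the product of its numerator and denominator,
    which is a positive constant over 1 - x, or over 3 at -1. *)
Lemma weight_gt0 x : root node_poly x -> x < 1 -> 0 < weight x.
Proof.
move=> Gx x1.
have K0 : 0 < 2 * (m%:R + 1) * (m%:R + 2) * (2 * m%:R + 3) :> R.
  by have := ler0n R m; move: (m%:R) => M M0; rewrite !mulr_gt0 //; lra.
suff VG : 0 < assoc_poly.[x] * (node_poly^`()).[x].
  have G0 : (node_poly^`()).[x] != 0.
    by apply: contraTneq VG => ->; rewrite mulr0 ltxx.
  have -> : weight x = assoc_poly.[x] * (node_poly^`()).[x] / (node_poly^`()).[x] ^+ 2.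
    by rewrite /weight; field.
  by rewrite divr_gt0 // exprn_even_gt0.
have [-> | xN1] := eqVneq x (-1).
  by rewrite -(pmulr_rgt0 _ (ltr0n R 3)) assoc_poly_node_poly_deriv_N1.
by rewrite -(pmulr_lgt0 _ (_ : 0 < 1 - x)) ?subr_gt0 // assoc_poly_node_poly_deriv.
Qed.

Variable rs : seq R.
Hypotheses (urs : uniq rs) (Grs : all (root node_poly) rs) (srs : size rs = m.+1).

(** Modulo [node_poly] the product of [assoc_poly] and S_(j+1) has degree below m
    when 1 <= j <= 2 m, so that the sum of its quotients by the derivative over
    the m + 1 roots vanishes. *)
Lemma quadrature_chebS j : (j <= m.*2)%N ->
  \sum_(x <- rs) weight x * (chebS j.+1).[x] = (j == 0)%N%:R.
Proof.
move=> jm.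
(* The multiple of [node_poly] is chosen so that only determinants remain. *)
pose D n := chebS j.+1 * chebS n - chebS j * chebS n.+1.
pose f := 2 *: (m.+2%:R *: D m + m.+1%:R *: D m.+1).
have fE : f = assoc_poly * chebS j.+1 - 2 *: (chebS j * node_poly).
  by rewrite /f /D /assoc_poly /node_poly -!mul_polyC; ring.
have fx x : x \in rs -> f.[x] = assoc_poly.[x] * (chebS j.+1).[x].
  move=> /(allP Grs)/eqP Gx.
  by rewrite fE hornerD hornerN hornerM (hornerZ 2 (_ * _)) hornerM Gx !mulr0 subr0.
have sD n k : (maxn (n - j) (j - n) <= k)%N -> (size (D n) <= k)%N.
  by move=> h; apply: leq_trans h; apply: size_chebS_det.
have sf k : (maxn (m - j) (j - m) <= k)%N -> (maxn (m.+1 - j) (j - m.+1) <= k)%N ->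
    (size f <= k)%N.
  move=> h1 h2; rewrite (leq_trans (size_scale_leq _ _)) //.
  rewrite (leq_trans (size_polyD _ _)) // geq_max.
  by rewrite !(leq_trans (size_scale_leq _ _)) // sD.
transitivity (\sum_(x <- rs) f.[x] / (node_poly^`()).[x]).
  by rewrite !big_seq; apply: eq_bigr => x xrs; rewrite fx // /weight mulrAC.
rewrite sum_lagrange_top_coef ?size_node_poly ?srs //; last by apply: sf; lia.
rewrite lead_coef_node_poly /=; have [j0 | j0] := posnP j; last first.
  by rewrite nth_default ?mul0r //; apply: sf; lia.
rewrite /f /D j0 /= !mul1r !mul0r !subr0 coefZ coefD !coefZ coef_chebS_lead.
by rewrite nth_default ?size_chebS_le // mulr0 add0r exprS mulrCA divff.
Qed.


Lemma quadrature_coef1 P : (size P <= m.*2.+2)%N ->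
  \sum_(x <- rs) weight x * (sin_quotient P).[x] = P`_1.
Proof.
move=> sP; rewrite (eq_bigr (fun x => \sum_(j < m.*2.+2) weight x * (P`_j * (chebS j).[x]))).
  rewrite exchange_big /= (bigD1 (Ordinal (isT : (1 < m.*2.+2)%N))) //= [X in _ + X]big1.
    rewrite addr0 (eq_bigr (fun x => P`_1 * (weight x * (chebS 1).[x]))).
      by rewrite -mulr_sumr quadrature_chebS // mulr1.
    by move=> x _; rewrite mulrCA.
  case=> [[|[|j]] /= jm] // _; first by rewrite big1 // => x _; rewrite horner0 !mulr0.
  rewrite (eq_bigr (fun x => P`_j.+2 * (weight x * (chebS j.+2).[x]))).
    by rewrite -mulr_sumr quadrature_chebS ?mulr0 // -ltnS.
  by move=> x _; rewrite mulrCA.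
by move=> x _; rewrite (horner_sin_quotient _ sP) mulr_sumr.
Qed.

(** Multiplication by 2 x shifts a sine polynomial both ways, so the second
    coefficient is a moment too. *)
Lemma quadrature_coef2 P : P`_0 = 0 -> (size P <= m.*2.+1)%N ->
  \sum_(x <- rs) weight x * (2 * x * (sin_quotient P).[x]) = P`_2.
Proof.
move=> P0 sP.
have sxP : (size ('X * P)%R <= m.*2.+2)%N.
  by rewrite -commr_polyX (leq_trans (size_polyMleq _ _)) // size_polyX addn2.
have sdP : (size (\poly_(i < m.*2) P`_i.+1)%R <= m.*2.+2)%N.
  by rewrite (leq_trans (size_poly _ _)) // -addn2 leq_addr.
have -> : P`_2 = ('X * P + \poly_(i < m.*2) P`_i.+1)`_1.
  rewrite coefD coefXM /= P0 add0r coef_poly; case: ltnP => // m2.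
  by rewrite nth_default // (leq_trans sP) // ltnS.
rewrite -quadrature_coef1; last by rewrite (leq_trans (size_polyD _ _)) // geq_max sxP.
apply: eq_bigr => x _; congr (_ * _).
rewrite sin_quotientD hornerD (horner_sin_quotient _ sP).
rewrite (horner_sin_quotient _ sxP) (horner_sin_quotient _ (size_poly _ _)).
rewrite big_ord_recl /= P0 mul0r add0r.
rewrite [X in _ = X + _]big_ord_recl /= horner0 mulr0 add0r.
rewrite [X in _ = X + _]big_ord_recl /= coefXM /= P0 mul0r add0r.
rewrite mulr_sumr -big_split /=; apply: eq_bigr => i _.
have step j : (j < m.*2)%N -> 2 * x * (P`_j.+1 * (chebS j.+1).[x]) =
    ('X * P)`_j.+2 * (chebS j.+2).[x] + (\poly_(k < m.*2) P`_k.+1)`_j * (chebS j).[x].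
  by move=> jm; rewrite coefXM /= -/(chebS j.+2) coef_poly jm horner_chebSS; ring.
exact: step.
Qed.

End Quadrature.

(** * The nodes, and the largest one *)

Section Nodes.
Variable R : realType.
Variable m : nat.
Implicit Types (x y t : R) (n k j : nat).

Local Notation chebS := (chebS R).
Local Notation node_poly := (node_poly R m).

(** Angles at which [node_poly] alternates in sign: m + 1 of them in (0, pi), which
    separate the m roots other than -1. *)
Definition alt_angle k : R := (2 * k%:R + 1) * pi / (2 * m%:R + 3).

Let M3_gt0 : 0 < 2 * m%:R + 3 :> R.
Proof. by have := ler0n R m; move: (m%:R) => M M0; lra. Qed.

Lemma alt_angle_itv k : (k <= m)%N -> 0 < alt_angle k < pi.
Proof.
move=> km; have pi0 := pi_gt0 R; have K0 := ler0n R k.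
have kM : k%:R <= m%:R :> R by rewrite ler_nat.
rewrite /alt_angle divr_gt0 //=; last by rewrite mulr_gt0 //; lra.
by rewrite ltr_pdivrMr // mulrC ltr_pM2l //; lra.
Qed.

Lemma alt_angle_lt k j : (k < j)%N -> alt_angle k < alt_angle j.
Proof.
move=> kj; rewrite /alt_angle ltr_pM2r ?invr_gt0 // ltr_pM2r ?pi_gt0 //.
by rewrite ltrD2r ltr_pM2l // ltr_nat.
Qed.

(** At these angles cos ((m + 3/2) t) = 0 and only the dominant term
    (2 m + 3) sin ((m + 3/2) t) cos (t / 2) survives. *)
Lemma node_poly_alt_sign k : (k <= m)%N -> 0 < (-1) ^+ k * node_poly.[cos (alt_angle k)].
Proof.
move=> km; have /andP[t0 tpi] := alt_angle_itv km.
set t := alt_angle k in t0 tpi *.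
have st : 0 < sin t by rewrite sin_gt0_pi // t0.
have ct : 0 < cos (t / 2) by rewrite cos_gt0_pihalf //; lra.
rewrite -(pmulr_rgt0 _ st) mulrCA horner_node_poly mulrDr !(mulrCA (sin t)) !chebS_cos.
pose a : R := pi / 2 + pi *+ k.
have aE : (m%:R + 3 / 2) * t = a.
  have h : 2 * m%:R + 3 != 0 :> R by rewrite gt_eqF.
  by rewrite /t /a /alt_angle -[pi *+ k]mulr_natl; field.
have -> : m.+1%:R * t = a - t / 2 by rewrite -aE -[m.+1%:R]natr1; field.
have -> : m.+2%:R * t = a + t / 2 by rewrite -aE -[m.+2%:R]natr1 -[m.+1%:R]natr1; field.
have sa : sin a = (-1) ^+ k by rewrite /a (alternatingn (@sinDpi R)) sin_pihalf mulr1.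
have ca : cos a = 0 by rewrite /a (alternatingn (@cosDpi R)) cos_pihalf mulr0.
rewrite sinB sinD ca sa -[m.+2%:R]natr1 -[m.+1%:R]natr1.
have e2 : (-1) ^+ k * (-1) ^+ k = 1 :> R by rewrite -expr2 sqrr_sign.
have -> : (-1) ^+ k * ((m%:R + 1 + 1) * ((-1) ^+ k * cos (t / 2) - 0 * sin (t / 2)) +
    (m%:R + 1) * ((-1) ^+ k * cos (t / 2) + 0 * sin (t / 2))) =
    ((-1) ^+ k * (-1) ^+ k) * ((2 * m%:R + 3) * cos (t / 2)) by ring.
by rewrite e2 mul1r mulr_gt0.
Qed.

Lemma node_poly_roots : exists rs : seq R,
  [/\ uniq rs, size rs = m.+1, all (root node_poly) rs &
      forall x, x \in rs -> -1 <= x < 1].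
Proof.
have cosmono k j : (k < j)%N -> (j <= m)%N -> cos (alt_angle j) < cos (alt_angle k).
  move=> kj jm.
  have itv i : (i <= m)%N -> alt_angle i \in `[0, pi].
    by move=> /alt_angle_itv/andP[h1 h2]; rewrite in_itv /= !ltW.
  by rewrite ltr_cos ?alt_angle_lt ?itv // (leq_trans (ltnW kj)).
have /choice[r rP] : forall k, exists x, (k < m)%N ->
    root node_poly x /\ cos (alt_angle k.+1) < x < cos (alt_angle k).
  move=> k; have [km|] := ltnP k m; last by exists 0.
  have [] := @polyrcf.poly_ivtoo R node_poly (cos (alt_angle k.+1)) (cos (alt_angle k)).
  - by rewrite ltW // cosmono.
  - have h1 := node_poly_alt_sign (ltnW km); have h2 := node_poly_alt_sign km.
    rewrite exprS mulN1r mulNr oppr_gt0 in h2.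
    move: (pmulr_llt0 ((-1) ^+ k * node_poly.[cos (alt_angle k.+1)]) h1).
    by rewrite h2 mulrACA -expr2 sqrr_sign mul1r.
  by move=> x; rewrite in_itv /= => hx rx; exists x.
have rmono k j : (k < j)%N -> (j < m)%N -> r j < r k.
  move=> kj jm; have [_ /andP[_ h1]] := rP _ jm.
  have [_ /andP[h2 _]] := rP _ (ltn_trans kj jm).
  apply: lt_trans h1 _; apply: le_lt_trans h2.
  by move: kj; rewrite leq_eqVlt => /predU1P[-> //|kj]; rewrite ltW // cosmono // ltnW.
have rgt k : (k < m)%N -> -1 < r k < 1.
  move=> km; have [_ /andP[h1 h2]] := rP _ km.
  by rewrite (le_lt_trans _ h1) ?cos_geN1 // (lt_le_trans h2) ?cos_le1.
exists (-1 :: [seq r k | k <- iota 0 m]); split.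
- rewrite /= map_inj_in_uniq ?iota_uniq ?andbT.
    apply/mapP => -[k]; rewrite mem_iota => /rgt /andP[+ _] e.
    by rewrite -e ltxx.
  move=> k j; rewrite !mem_iota !add0n => km jm e.
  by case: (ltngtP k j) => // /rmono/=; [move/(_ jm)|move/(_ km)]; rewrite e ltxx.
- by rewrite /= size_map size_iota.
- rewrite /= node_poly_N1; apply/allP => x /mapP[k]; rewrite mem_iota => km ->.
  by have [] := rP _ km.
move=> x; rewrite inE => /predU1P[-> | /mapP[k]]; first by rewrite lexx ltrN10 || lra.
by rewrite mem_iota => /rgt/andP[h1 h2] ->; rewrite ltW.
Qed.

Lemma node_poly_neq0 : node_poly != 0.
Proof. by rewrite -size_poly_eq0 size_node_poly. Qed.

Lemma node_poly_root_mem rs x : uniq rs -> size rs = m.+1 -> all (root node_poly) rs ->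
  root node_poly x -> x \in rs.
Proof.
move=> urs srs Grs Gx; apply/negPn/negP => xrs.
have := @max_poly_roots R node_poly (x :: rs) node_poly_neq0.
by rewrite /= Gx Grs xrs urs srs size_node_poly ltnn => /(_ isT isT).
Qed.

(** The half-angle substitution y = sin (t / 2), x = cos t = 1 - 2 y ^ 2, which
    reverses the order: the smallest positive root on the left corresponds to
    the largest root of [node_poly]. *)
Lemma chebU_deriv_node_poly y :
  (1 - y ^+ 2) * ((chebU R (m.*2 + 2))^`()).[y] =
  2 * (-1) ^+ m * y * node_poly.[1 - 2 * y ^+ 2].
Proof.
have -> : chebU R (m.*2 + 2) = chebS m.*2.+3 by rewrite addn2.
rewrite chebS_deriv horner_node_poly.
have yS : y * (chebS m.*2.+3).[y] = ((chebS m.*2.+4).[y] + (chebS m.*2.+2).[y]) / 2.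
  by rewrite [in RHS]horner_chebSS; field.
have -> : (m.*2.+3%:R + 1) * y * (chebS m.*2.+3).[y] =
    (m.*2.+3%:R + 1) * (y * (chebS m.*2.+3).[y]) by ring.
rewrite yS.
have -> : chebS m.*2.+4 = chebS (m.+2).*2 by [].
have -> : chebS m.*2.+2 = chebS (m.+1).*2 by [].
rewrite !chebS_double.
have -> : 1 - 2 * y ^+ 2 = - (2 * y ^+ 2 - 1) by ring.
rewrite !chebS_opp !exprS.
have -> : m.*2.+3%:R = 2 * m%:R + 3 :> R by rewrite -addn3 natrD -muln2 natrM mulrC.
have e2 : (-1) ^+ m * (-1) ^+ m = 1 :> R by rewrite -expr2 sqrr_sign.
rewrite -[m.+2%:R]natr1 -[m.+1%:R]natr1.
move: (chebS m.+1).[_] (chebS m.+2).[_] => a b.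
have -> : 2 * (-1) ^+ m * y * ((m%:R + 1 + 1) * (-1 * (-1 * (-1) ^+ m) * a)
    + (m%:R + 1) * (-1 * (-1 * (-1 * (-1) ^+ m)) * b)) =
  ((-1) ^+ m * (-1) ^+ m) * (2 * y * ((m%:R + 2) * a - (m%:R + 1) * b)) by ring.
by rewrite e2; field.
Qed.

Definition largest_node (eta : R) :=
  [/\ root node_poly eta, -1 < eta, eta < 1 & forall x, root node_poly x -> x <= eta].

Lemma largest_node_exists : (0 < m)%N -> exists eta, largest_node eta.
Proof.
move=> m0; have [rs [urs srs Grs rs1]] := node_poly_roots.
have [e ers emax] : exists2 e, e \in rs & forall x, x \in rs -> x <= e.
  have : rs != [::] by rewrite -size_eq0 srs.
  elim: (rs) => [//|a s IH _].
  have [-> | /IH [e es emax]] := eqVneq s [::].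
    by exists a; rewrite ?mem_head // => x; rewrite inE => /eqP ->.
  have [ae | /ltW ea] := leP a e.
    by exists e; rewrite ?inE ?es ?orbT // => x /predU1P[-> // | /emax].
  exists a; rewrite ?mem_head // => x /predU1P[-> // | /emax xe].
  exact: le_trans xe ea.
have /andP[eN1 e1] := rs1 _ ers.
exists e; split=> //; first exact: (allP Grs).
  rewrite lt_neqAle eN1 andbT; apply/eqP => eE.
  have : (size rs <= size [:: (-1 : R)%R])%N.
    apply: uniq_leq_size => // x xrs; rewrite inE eq_le.
    by have /andP[-> _] := rs1 _ xrs; rewrite eE emax.
  by rewrite srs ltnS leqNgt m0.
by move=> x Gx; apply: emax; apply: node_poly_root_mem Gx.
Qed.

Lemma node_poly_root_lt1 x : root node_poly x -> -1 <= x < 1.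
Proof.
have [rs [urs srs Grs rs1]] := node_poly_roots => Gx.
by apply: rs1; apply: node_poly_root_mem Gx.
Qed.

Let nu_of (eta : R) := Num.sqrt ((1 - eta) / 2).

Let nu_ofP eta : -1 < eta < 1 ->
  [/\ 0 < nu_of eta, nu_of eta < 1 & 1 - 2 * nu_of eta ^+ 2 = eta].
Proof.
move=> /andP[e1 e2]; rewrite /nu_of sqr_sqrtr; last by lra.
rewrite sqrtr_gt0; split; [by lra | | by field].
by rewrite -[ltRHS]sqrtr1 ltr_sqrt; lra.
Qed.

Let chebU_deriv_root y : 0 < y < 1 ->
  root ((chebU R (m.*2 + 2))^`()) y = root node_poly (1 - 2 * y ^+ 2).
Proof.
move=> /andP[y0 y1]; have := chebU_deriv_node_poly y.
have y21 : 1 - y ^+ 2 != 0 by rewrite subr_eq0 eq_sym lt_eqF // exprn_ilt1 // ltW.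
have cy : 2 * (-1) ^+ m * y != 0 by rewrite !mulf_neq0 ?signr_eq0 ?gt_eqF.
move=> dE; rewrite !rootE -[RHS](mulrI_eq0 _ (lregP cy)) -dE.
by rewrite (mulrI_eq0 _ (lregP y21)).
Qed.

Lemma is_nu_exists : (0 < m)%N -> exists nu : R, is_nu m.*2 nu.
Proof.
move=> /largest_node_exists[e [Ge eN1 e1 emax]].
have [n0 n1 nE] := nu_ofP (introT andP (conj eN1 e1)).
exists (nu_of e); split=> //; first by rewrite chebU_deriv_root ?n0 // nE.
move=> y y0; have [y1 | y1 _] := ltP y 1; last by rewrite (le_trans (ltW n1)).
rewrite chebU_deriv_root ?y0 // => /emax ye.
by rewrite -(ler_pXn2r (ltn0Sn 1)) ?nnegrE ?(ltW n0) ?(ltW y0) //; lra.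
Qed.

Lemma is_nu_largest_node (nu : R) : (0 < m)%N -> is_nu m.*2 nu ->
  largest_node (eta_ nu).
Proof.
move=> m0 [nu0 rnu numin]; rewrite /eta_.
have small x : root node_poly x -> -1 < x < 1 -> x <= 1 - 2 * nu ^+ 2 /\ nu < 1.
  move=> Gx x1; have [n0 n1 nE] := nu_ofP x1.
  have nun : nu <= nu_of x by apply: numin => //; rewrite chebU_deriv_root ?n0 // nE.
  split; last exact: le_lt_trans nun n1.
  by rewrite -[leLHS]nE lerD2l lerN2 ler_pM2l // ler_pXn2r // nnegrE ltW.
have [e [Ge eN1 e1 emax]] := largest_node_exists m0.
have [_ nu1] := small e Ge (introT andP (conj eN1 e1)).
have nu2 : 0 < nu ^+ 2 < 1 by rewrite exprn_gt0 //= exprn_ilt1 // ltW.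
split.
- by rewrite -chebU_deriv_root ?nu0.
- by lra.
- by lra.
move=> x Gx; have /andP[xN1 x1] := node_poly_root_lt1 Gx.
have [-> | xN1'] := eqVneq x (-1); first by lra.
by have [] := small x Gx; rewrite // lt_neqAle eq_sym xN1' xN1.
Qed.

End Nodes.

(** * Maximizing the second coefficient of a non-negative sine polynomial *)

Section Extremal.
Variable R : realType.
Implicit Types (x y t : R) (n k j : nat) (P : {poly R}).

Local Notation chebS := (chebS R).

Lemma horner_ge0_right (p : {poly R}) x y : x < y ->
  (forall t, x < t < y -> 0 <= p.[t]) -> 0 <= p.[x].
Proof.
move=> xy pge.
apply: (@cvgr_to_ge _ x^'+ _ R (horner p) _ 0).
  by apply: cvg_at_right_filter; exact: continuous_horner.
near=> t; apply: pge; apply/andP; split; near: t.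
  exact: nbhs_right_gt.
exact: nbhs_right_lt.
Unshelve. all: by end_near. Qed.

Lemma horner_ge0_left (p : {poly R}) x y : x < y ->
  (forall t, x < t < y -> 0 <= p.[t]) -> 0 <= p.[y].
Proof.
move=> xy pge; have -> : p.[y] = (p \Po (- 'X)).[- y].
  by rewrite horner_comp !hornerE opprK.
apply: (@horner_ge0_right _ _ (- x)); first by rewrite ltrN2.
move=> t /andP[t1 t2]; rewrite horner_comp !hornerE; apply: pge.
by rewrite ltrNr t2 ltrNl t1.
Qed.

(** Otherwise the polynomial would change sign at x. *)
Lemma double_root_of_ge0 (p : {poly R}) a b x : a < x < b ->
  (forall t, a <= t <= b -> 0 <= p.[t]) -> p.[x] = 0 -> (p^`()).[x] = 0.
Proof.
move=> /andP[ax xb] pge px.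
have /factor_theorem[q pE] : root p x by rewrite rootE px.
have -> : (p^`()).[x] = q.[x].
  by rewrite pE derivM derivXsubC mulr1 !hornerE subrr mulr0 add0r.
apply/eqP; rewrite eq_le; apply/andP; split.
  rewrite -oppr_ge0 -hornerN; apply: (horner_ge0_left ax) => t /andP[at_ tx].
  have := pge t; rewrite pE hornerM hornerXsubC hornerN oppr_ge0 (ltW at_) /=.
  by rewrite (ltW (lt_trans tx xb)) => /(_ isT); rewrite nmulr_lge0 // subr_lt0.
apply: (horner_ge0_right xb) => t /andP[xt tb].
have := pge t; rewrite pE hornerM hornerXsubC (ltW tb) (ltW (lt_trans ax xt)).
by move=> /(_ isT); rewrite pmulr_lge0 // subr_gt0.
Qed.

Definition nonneg_sine_poly N P :=
  [/\ (size P <= N.+1)%N, P`_0 = 0, P`_1 = 1 &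
      forall x, -1 <= x <= 1 -> 0 <= (sin_quotient P).[x]].

Variable m : nat.
Hypothesis m0 : (0 < m)%N.
Local Notation node_poly := (node_poly R m).
Variable eta : R.
Hypothesis eta_max : largest_node m eta.

Let xs_spec (xs : seq R) :=
  [/\ uniq [:: eta, -1 & xs], size xs = m.-1, all (root node_poly) [:: eta, -1 & xs] &
      forall x, x \in xs -> -1 < x < eta].

Let xs_exists : exists xs, xs_spec xs.
Proof.
have [Ge eN1 e1 emax] := eta_max.
have [rs [urs srs Grs rs1]] := node_poly_roots R m.
have ers : eta \in rs by exact: node_poly_root_mem Ge.
have nrs : -1 \in rem eta rs.
  by rewrite mem_rem_uniq // inE lt_eqF //= (node_poly_root_mem urs srs Grs) // node_poly_N1.
exists (rem (-1) (rem eta rs)).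
have pe : perm_eq rs [:: eta, -1 & rem (-1) (rem eta rs)].
  by rewrite (perm_trans (perm_to_rem ers)) // perm_cons perm_to_rem.
split.
- by rewrite -(perm_uniq pe).
- by rewrite size_rem // size_rem // srs.
- by rewrite -(perm_all _ pe).
move=> x; rewrite (mem_rem_uniq _ (rem_uniq _ urs)) inE => /andP[xN1].
rewrite mem_rem_uniq // inE => /andP[xe xrs].
have /andP[h _] := rs1 _ xrs; rewrite !lt_neqAle h xe eq_sym xN1 /=.
by rewrite emax // (allP Grs).
Qed.

Let simple_part (xs : seq R) : {poly R} := \prod_(x <- xs) ('X - x%:P).

Let node_poly_split xs : xs_spec xs -> node_poly =
  lead_coef node_poly *: (('X - eta%:P) * (('X + 1) * simple_part xs)).
Proof.
move=> [uxs sxs Gxs _].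
have s2 : size [:: eta, -1 & xs] = m.+1 by rewrite /= sxs prednK.
rewrite {1}(all_roots_prod_XsubC _ Gxs) ?uniq_rootsE //; last by rewrite size_node_poly s2.
by rewrite !big_cons polyCN opprK.
Qed.

Let K : R := 2 * (m%:R + 1) * (m%:R + 2) * (2 * m%:R + 3).

Let K_gt0 : 0 < K.
Proof.
by rewrite /K; have := ler0n R m; move: (m%:R) => M M0; rewrite !mulr_gt0 //; lra.
Qed.

Lemma Q_E : Q_ m.*2 eta = (1 - eta ^+ 2) / K.
Proof.
have : m.*2%:R = 2 * m%:R :> R by rewrite -muln2 natrM mulrC.
rewrite /Q_ /K => ->; have := ler0n R m; move: (m%:R) => M M0.
have [h1 h2 h3] : [/\ M + 1 != 0, M + 2 != 0 & 2 * M + 3 != 0].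
  by split; rewrite gt_eqF //; lra.
have [h4 h5] : 2 * M + 2 != 0 /\ 2 * M + 4 != 0.
  by split; rewrite gt_eqF //; lra.
by field; rewrite h1 h2 h3 h4 h5.
Qed.

Lemma Q_gt0 : 0 < Q_ m.*2 eta.
Proof.
have [_ eN1 e1 _] := eta_max.
rewrite Q_E divr_gt0 //.
have -> : 1 - eta ^+ 2 = (1 - eta) * (1 + eta) by ring.
by rewrite mulr_gt0 //; lra.
Qed.

(** The value of the extremal quotient at [eta] times the weight there: this
    is where the constant [Q_] comes from. *)
Let weight_at_eta (q : {poly R}) (c : R) xs : xs_spec xs ->
  q = c *: (('X + 1) * (lead_coef node_poly *: simple_part xs) ^+ 2) ->
  weight m eta * q.[eta] = c / Q_ m.*2 eta.
Proof.
move=> xsP qE; have [Ge eN1 e1 _] := eta_max.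
have := assoc_poly_node_poly_deriv Ge _; rewrite -/K => /(_ (negbT (gt_eqF eN1))) VG.
have dG : (node_poly^`()).[eta] =
    (1 + eta) * (lead_coef node_poly * (simple_part xs).[eta]).
  rewrite {1}(node_poly_split xsP); move: (simple_part xs) (lead_coef _) => B g.
  by rewrite derivZ derivM derivXsubC mul1r !hornerE /=; ring.
have Gn0 : (node_poly^`()).[eta] != 0.
  by apply/eqP => G0; move: K_gt0; rewrite -VG G0 mulr0 mul0r ltxx.
have n1 : 1 + eta != 0 by rewrite gt_eqF //; lra.
have n2 : 1 - eta != 0 by rewrite gt_eqF //; lra.
have -> : q.[eta] = c * ((node_poly^`()).[eta] ^+ 2 / (1 + eta)).
  rewrite qE dG; move: (simple_part xs) (lead_coef _) => B g.
  by rewrite !hornerE /=; field.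
rewrite Q_E -VG /weight; move: Gn0 VG; move: (assoc_poly R m).[eta] (node_poly^`()).[eta].
move=> v g g0 VG; have v0 : v != 0.
  by apply/eqP => v0; move: K_gt0; rewrite -VG v0 !mul0r ltxx.
have -> : 1 - eta ^+ 2 = (1 - eta) * (1 + eta) by ring.
by field; rewrite n1 n2 g0 v0.
Qed.

(** The dual certificate of the extremal problem: the nodes lie to the left of
    [eta], so each term is non-negative when the sine quotient is. *)
Let moments P xs : xs_spec xs -> (size P <= m.*2.+1)%N -> P`_0 = 0 ->
  \sum_(x <- [:: eta, -1 & xs])
     weight m x * (2 * (eta - x) * (sin_quotient P).[x]) = 2 * eta * P`_1 - P`_2.
Proof.
move=> [uxs sxs Gxs _] sP P0.
have s2 : size [:: eta, -1 & xs] = m.+1 by rewrite /= sxs prednK.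
rewrite -(quadrature_coef1 uxs Gxs s2) ?(leqW sP) //.
rewrite -(quadrature_coef2 uxs Gxs s2 P0) // mulr_sumr -sumrB.
by apply: eq_bigr => x _; ring.
Qed.

Let moment_term_ge0 P xs x : xs_spec xs -> nonneg_sine_poly m.*2 P ->
  x \in [:: eta, -1 & xs] ->
  0 <= weight m x * (2 * (eta - x) * (sin_quotient P).[x]).
Proof.
move=> [uxs sxs Gxs _] [_ _ _ Pge] xin.
have Gx := allP Gxs _ xin; have [_ _ _ /(_ _ Gx) xe] := eta_max.
have /andP[xN1 x1] := node_poly_root_lt1 Gx.
apply: mulr_ge0; first by rewrite ltW // weight_gt0.
rewrite !mulr_ge0 // ?subr_ge0 //.
by rewrite Pge // xN1 ltW.
Qed.

Lemma coef2_le P : nonneg_sine_poly m.*2 P -> P`_2 <= 2 * eta.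
Proof.
move=> Pge; have [xs xsP] := xs_exists; have [sP P0 P1 _] := Pge.
have := moments xsP sP P0; rewrite P1 mulr1 -subr_ge0 => <-.
by rewrite big_seq sumr_ge0 // => x; apply: moment_term_ge0.
Qed.

(** The quotient is Q G ^ 2 / ((1 + x) (x - eta) ^ 2), cleared of denominators
    to be an identity between polynomials; it determines P. *)
Definition extremal_quotient P :=
  sin_quotient P * (('X + 1) * ('X - eta%:P) ^+ 2) = Q_ m.*2 eta *: node_poly ^+ 2.

Let split_identity (q : {poly R}) c xs : xs_spec xs ->
  q = c *: (('X + 1) * (lead_coef node_poly *: simple_part xs) ^+ 2) ->
  q * (('X + 1) * ('X - eta%:P) ^+ 2) = c *: node_poly ^+ 2.
Proof.
move=> xsP ->; rewrite [in RHS](node_poly_split xsP) -!mul_polyC; ring.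
Qed.

(** Equality forces a zero at every node but [eta], hence by non-negativity
    double zeros at the interior ones; this exhausts the degree. *)
Lemma extremal_of_coef2 P : nonneg_sine_poly m.*2 P -> P`_2 = 2 * eta ->
  extremal_quotient P.
Proof.
move=> Pge P2; have [xs xsP] := xs_exists; have [sP P0 P1 qge] := Pge.
have [_ eN1 e1 _] := eta_max.
have [uxs sxs Gxs xsin] := xsP.
set q := sin_quotient P in qge *.
have q0 x : x \in -1 :: xs -> q.[x] = 0.
  move=> xin; have xin' : x \in [:: eta, -1 & xs] by rewrite inE xin orbT.
  have xe : eta - x != 0.
    rewrite subr_eq0; apply: contraTneq xin => <-.
    by have /andP[] : uniq (eta :: (-1 :: xs)) by [].
  have /eqP := moments xsP sP P0; rewrite P1 P2 mulr1 subrr big_seq.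
  rewrite psumr_eq0 => [/allP/(_ x xin')|y yin]; last exact: (moment_term_ge0 xsP Pge yin).
  have Gx := allP Gxs _ xin'; have /andP[_ x1] := node_poly_root_lt1 Gx.
  rewrite xin' /= mulf_eq0 (gt_eqF (weight_gt0 Gx x1)) /= !mulf_eq0 (negPf xe).
  by rewrite pnatr_eq0 => /eqP.
have uxs1 : uniq (-1 :: xs) by have /andP[] : uniq (eta :: (-1 :: xs)) by [].
have /dvdpP[q1 qE1] : ('X + 1) * simple_part xs %| q.
  have -> : ('X + 1) * simple_part xs = \prod_(x <- -1 :: xs) ('X - x%:P).
    by rewrite big_cons polyCN opprK.
  apply: uniq_roots_dvdp; rewrite ?uniq_rootsE //.
  by apply/allP => x /q0; rewrite rootE => ->.
(* The simple factors are already divided out, so a zero of the derivative of q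
   at a node is a zero of the cofactor q1. *)
have /dvdpP[q2 qE2] : simple_part xs %| q1.
  apply: uniq_roots_dvdp; last by rewrite uniq_rootsE; case/andP: uxs1.
  apply/allP => x xin; have /andP[xN1 xe] := xsin _ xin.
  have : (q^`()).[x] = 0.
    apply: (double_root_of_ge0 (a := -1) (b := 1)) => //.
      by rewrite xN1 (lt_trans xe).
    by apply: q0; rewrite inE xin orbT.
  rewrite qE1 {1}/simple_part (perm_big _ (perm_to_rem xin)) big_cons.
  set r := \prod_(_ <- _) _.
  have -> : (q1 * (('X + 1) * (('X - x%:P) * r)))^`().[x] = q1.[x] * ((x + 1) * r.[x]).
    rewrite (_ : _ * _ = (q1 * (('X + 1) * r)) * ('X - x%:P)); last by ring.
    by rewrite derivM derivXsubC mulr1 !hornerE subrr mulr0 add0r.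
  move=> /eqP; rewrite !mulf_eq0 rootE => /or3P[// | | r0].
    by rewrite gt_eqF //; lra.
  move: r0; rewrite -/(root r x) root_prod_XsubC mem_rem_uniqF //.
  by case/andP: uxs1.
pose g := lead_coef node_poly.
have g0 : g != 0 by rewrite lead_coef_eq0 node_poly_neq0.
have sB : size (simple_part xs) = m by rewrite size_prod_XsubC sxs prednK.
have B0 : simple_part xs != 0 by rewrite -size_poly_eq0 sB -lt0n.
have X1 : ('X + 1 : {poly R}) != 0 by rewrite -size_poly_eq0 size_XaddC.
have qE : q = q2 * (('X + 1) * simple_part xs ^+ 2) by rewrite qE1 qE2; ring.
have sD : size (('X + 1) * simple_part xs ^+ 2) = m.*2.
  rewrite size_mul ?expf_neq0 // size_XaddC expr2 size_mul // sB.
  by rewrite -addnn; case: (m) m0.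
have sq2 : (size q2 <= 1)%N.
  have [-> | q20] := eqVneq q2 0; first by rewrite size_poly0.
  have : (size q <= m.*2)%N by apply: size_sin_quotient.
  rewrite qE size_mul ?mulf_neq0 ?expf_neq0 // sD.
  have : (0 < m.*2)%N by rewrite double_gt0.
  by move: (size q2) (m.*2) => a b; lia.
have qE' : q = (q2`_0 / g ^+ 2) *: (('X + 1) * (g *: simple_part xs) ^+ 2).
  rewrite qE {1}(size1_polyC sq2) exprZn -scalerAr scalerA divfK ?expf_neq0 //.
  by rewrite mul_polyC.
have := weight_at_eta xsP qE'.
have s2 : size [:: eta, -1 & xs] = m.+1 by rewrite /= sxs prednK.
have := quadrature_coef1 uxs Gxs s2 (leqW sP); rewrite P1 big_cons big_seq big1.
  rewrite addr0 => -> cE; rewrite /extremal_quotient -/q (split_identity xsP qE').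
  suff -> : q2`_0 / g ^+ 2 = Q_ m.*2 eta by [].
  by apply: (mulIf (invr_neq0 (lt0r_neq0 Q_gt0))); rewrite -cE divff ?gt_eqF ?Q_gt0.
by move=> x /q0 ->; rewrite mulr0.
Qed.

(** The square in the extremal quotient makes it non-negative whatever the
    position of the nodes. *)
Lemma extremal_exists : exists2 P, nonneg_sine_poly m.*2 P & P`_2 = 2 * eta.
Proof.
have [xs xsP] := xs_exists; have [uxs sxs Gxs xsin] := xsP.
have s2 : size [:: eta, -1 & xs] = m.+1 by rewrite /= sxs prednK.
pose g := lead_coef node_poly.
pose q := Q_ m.*2 eta *: (('X + 1) * (g *: simple_part xs) ^+ 2).
have sB : size (simple_part xs) = m by rewrite size_prod_XsubC sxs prednK.
have sgB : (size (g *: simple_part xs)%R <= m)%N by rewrite -sB size_scale_leq.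
have sq : (size q <= m.*2)%N.
  rewrite (leq_trans (size_scale_leq _ _)) // (leq_trans (size_polyMleq _ _)) //.
  have : (size ((g *: simple_part xs) ^+ 2)%R <= (m + m).-1)%N.
    rewrite expr2 (leq_trans (size_polyMleq _ _)) //.
    by move: sgB; move: (size _) => a; lia.
  by rewrite size_XaddC -addnn; move: m0 (size _) => m1 a; lia.
have [P [sP P0 qP]] := sin_quotient_onto sq.
have qx x : q.[x] = Q_ m.*2 eta * ((x + 1) * (g * (simple_part xs).[x]) ^+ 2).
  by rewrite hornerZ hornerM horner_exp hornerZ hornerD hornerX hornerC.
have q0 x : x \in -1 :: xs -> q.[x] = 0.
  rewrite inE qx => /predU1P[-> | xin]; first by rewrite addNr mul0r mulr0.
  have /eqP -> : root (simple_part xs) x by rewrite root_prod_XsubC.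
  by rewrite mulr0 expr0n /= !mulr0.
have wE := weight_at_eta xsP (erefl q).
rewrite divff ?lt0r_neq0 ?Q_gt0 // in wE.
have P1 : P`_1 = 1.
  rewrite -(quadrature_coef1 uxs Gxs s2 (leqW sP)) qP big_cons wE big_seq big1 ?addr0 //.
  by move=> x /q0 ->; rewrite mulr0.
have P2 : P`_2 = 2 * eta.
  rewrite -(quadrature_coef2 uxs Gxs s2 P0 sP) qP big_cons mulrCA wE big_seq big1.
    by rewrite mulr1 addr0.
  by move=> x /q0 ->; rewrite !mulr0.
exists P => //; split=> // x /andP[xN1 x1]; rewrite qP.
rewrite qx; apply: mulr_ge0; first exact: ltW Q_gt0.
by rewrite mulr_ge0 ?sqr_ge0 //; lra.
Qed.

Lemma extremal_unique (P S : {poly R}) : P`_0 = 0 -> S`_0 = 0 ->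
  extremal_quotient P -> extremal_quotient S -> P = S.
Proof.
move=> P0 S0; rewrite /extremal_quotient => <- /esym eqPS.
apply: sin_quotient_inj; rewrite ?P0 ?S0 //.
by apply: mulIf eqPS; rewrite mulf_neq0 ?expf_neq0 ?polyXsubC_eq0 // -size_poly_eq0 size_XaddC.
Qed.

End Extremal.

(** * Typically real polynomials are the non-negative sine polynomials *)

Section ComplexEvaluation.
Variable R : realType.
Local Notation C := R[i].
Local Notation chebS := (chebS R).
Implicit Types (x y s t : R) (z w : C) (P : {poly R}) (n k j : nat).

Lemma ImD z w : complex.Im (z + w) = complex.Im z + complex.Im w.
Proof. by case: z w => [a b] [c d]. Qed.

Lemma ImN z : complex.Im (- z) = - complex.Im z.
Proof. by case: z. Qed.

Lemma ImMr (a : R) z : complex.Im (a%:C%C * z) = a * complex.Im z.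
Proof. by case: z => [b c] /=; rewrite mul0r addr0. Qed.

Lemma Im_sum (I : Type) (r : seq I) (P : pred I) (F : I -> C) :
  complex.Im (\sum_(i <- r | P i) F i) = \sum_(i <- r | P i) complex.Im (F i).
Proof. exact: (big_morph (@complex.Im R) ImD (erefl _)). Qed.

Lemma normC_lt1 x y : (`|(x +i* y)%C| < 1) = (x ^+ 2 + y ^+ 2 < 1).
Proof. by rewrite normc_def /= (ltcR _ 1) -[X in _ < X]sqrtr1 ltr_sqrt. Qed.

Lemma evalCE P z : evalC P z = \sum_(j < size P) (P`_j)%:C%C * z ^+ j.
Proof.
rewrite /evalC horner_coef size_map_poly.
by apply: eq_bigr => j _; rewrite coef_map.
Qed.

Lemma evalC_real P x : evalC P x%:C%C = (P.[x])%:C%C.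
Proof. exact: horner_map. Qed.

Lemma evalC_conj P z : evalC P (conjc z) = conjc (evalC P z).
Proof.
rewrite !evalCE rmorph_sum /=; apply: eq_bigr => j _.
by rewrite rmorphM rmorphXn /= oppr0.
Qed.

Lemma evalC_MX P (c : R) z : evalC (P * 'X + c%:P) z = evalC P z * z + c%:C%C.
Proof. by rewrite /evalC rmorphD rmorphM /= map_polyX map_polyC !hornerE. Qed.

Lemma Im_expr_unit x y n : x ^+ 2 + y ^+ 2 = 1 ->
  complex.Im ((x +i* y)%C ^+ n) = y * (chebS n).[x].
Proof.
move=> xy; elim/chebS_ind2: n => [||n IH1 IH2].
- by rewrite horner0 mulr0.
- by rewrite hornerE mulr1.
have sq : (x +i* y)%C ^+ 2 = (2 * x)%:C%C * (x +i* y)%C - 1.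
  rewrite expr2; apply/eqP; rewrite eq_complex /=; apply/andP; split; apply/eqP.
    by lra.
  by ring.
have -> : (x +i* y)%C ^+ n.+2 =
    (2 * x)%:C%C * (x +i* y)%C ^+ n.+1 - (x +i* y)%C ^+ n.
  have -> : (x +i* y)%C ^+ n.+2 = (x +i* y)%C ^+ 2 * (x +i* y)%C ^+ n by rewrite -exprD.
  by rewrite sq exprS; move: (x +i* y)%C (2 * x)%:C%C => w c; rewrite mulrBl mul1r mulrA.
by rewrite ImD ImN ImMr IH1 IH2 horner_chebSS; ring.
Qed.

Lemma Im_evalC_polar P (r : R) x y : x ^+ 2 + y ^+ 2 = 1 ->
  complex.Im (evalC P (r%:C%C * (x +i* y)%C)) =
  y * (\poly_(j < size P) (P`_j * (chebS j).[x])).[r].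
Proof.
move=> xy; rewrite evalCE Im_sum horner_poly mulr_sumr; apply: eq_bigr => j _.
by rewrite exprMn ImMr -rmorphXn ImMr Im_expr_unit //; ring.
Qed.

Lemma Im_evalC_circle P x y : x ^+ 2 + y ^+ 2 = 1 ->
  complex.Im (evalC P (x +i* y)%C) = y * (sin_quotient P).[x].
Proof.
move=> xy; have := Im_evalC_polar P 1 xy; rewrite mul1r => ->.
rewrite horner_poly (horner_sin_quotient _ (leqnn _)); congr (_ * _).
by apply: eq_bigr => j _; rewrite expr1n mulr1.
Qed.

(** Inside the disk the sign is given; the circle is reached along radii, and the
    end points -1 and 1 by continuity of the sine quotient. *)
Lemma nonneg_of_typically_real N P :
  typically_real_poly N P -> nonneg_sine_poly N P.
Proof.
move=> [sP P0 P1 [_ _ Ppos]]; split=> //.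
have inside x : -1 < x < 1 -> 0 <= (sin_quotient P).[x].
  move=> /andP[xN1 x1]; pose y := Num.sqrt (1 - x ^+ 2).
  have x2 : 0 < 1 - x ^+ 2.
    have -> : 1 - x ^+ 2 = (1 - x) * (1 + x) by ring.
    by rewrite mulr_gt0 //; lra.
  have y0 : 0 < y by rewrite sqrtr_gt0.
  have xy : x ^+ 2 + y ^+ 2 = 1 by rewrite sqr_sqrtr ?ltW //; ring.
  pose f := \poly_(j < size P) (P`_j * (chebS j).[x]).
  have -> : (sin_quotient P).[x] = f.[1].
    rewrite horner_poly (horner_sin_quotient _ (leqnn _)).
    by apply: eq_bigr => j _; rewrite expr1n mulr1.
  apply: (horner_ge0_left (@ltr01 R)) => r /andP[r0 r1].
  pose z : C := (r * x +i* (r * y))%C.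
  have zE : z = r%:C%C * (x +i* y)%C.
    by apply/eqP; rewrite eq_complex /= !mul0r subr0 addr0 !eqxx.
  have z1 : `|z| < 1.
    rewrite normC_lt1; have -> : (r * x) ^+ 2 + (r * y) ^+ 2 = r ^+ 2.
      by rewrite -[RHS]mulr1 -[X in _ = _ * X]xy; ring.
    by rewrite exprn_ilt1 // ltW.
  have ry : 0 < r * y by rewrite mulr_gt0.
  have := Ppos z z1; rewrite zE Im_evalC_polar // -zE /= (gt_eqF ry).
  by move=> /(_ isT); rewrite pmulr_lgt0 // pmulr_rgt0 // => /ltW.
move=> x /andP[]; rewrite le_eqVlt => /predU1P[<- _ | xN1].
  by apply: (@horner_ge0_right _ _ _ 0) => [|t /andP[t1 t2]]; [lra|apply: inside; lra].
rewrite le_eqVlt => /predU1P[-> | x1]; last by rewrite inside ?xN1.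
by apply: (@horner_ge0_left _ _ 0) => [|t /andP[t1 t2]]; [lra|apply: inside; lra].
Qed.

(** The open mapping property: near z0 the polynomial is P z0 + c (z - z0) ^ k
    to leading order, and some direction makes c (z - z0) ^ k a negative
    multiple of i. *)
Lemma Im_poly_no_local_min (P : {poly C}) (z0 : C) (rho : R) :
  (1 < size P)%N -> 0 < rho ->
  ~ (forall z, `|z - z0| < rho%:C%C -> complex.Im P.[z0] <= complex.Im P.[z]).
Proof.
move=> sP rho0 Pmin; pose D := P - (P.[z0])%:P.
have D0 : D != 0.
  rewrite subr_eq0; apply: contraTneq sP => ->.
  by rewrite -leqNgt size_polyC_leq1.
have [k [Q]] := multiplicity_XsubC D z0; rewrite D0 /= => Q0 DE.
have k0 : (0 < k)%N.
  rewrite lt0n; apply: contraNneq Q0 => k0; rewrite rootE.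
  have : D.[z0] = 0 by rewrite !hornerE subrr.
  by rewrite DE k0 expr0 mulr1 => ->.
set c := Q.[z0]; have c0 : c != 0 by [].
(* With w ^ k = u, a step s w changes the polynomial by s ^ k u Q (z0 + s w),
   whose leading part is - i s ^ k |c| ^ 2. *)
pose u : C := - 'i%C * conjc c; pose w := k.-root u.
have wk : w ^+ k = u by rewrite rootCK.
pose Qt := Q \Po (w *: 'X + z0%:P).
pose f := \poly_(j < size Qt) complex.Im (u * Qt`_j).
have fE s : f.[s] = complex.Im (u * Q.[z0 + s%:C%C * w]).
  have -> : Q.[z0 + s%:C%C * w] = Qt.[s%:C%C].
    by rewrite horner_comp !hornerE /= addrC mulrC.
  rewrite (horner_coef Qt) mulr_sumr Im_sum horner_poly; apply: eq_bigr => j _.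
  by rewrite -rmorphXn mulrA [X in _ = complex.Im X]mulrC ImMr mulrC.
have f0 : f.[0] < 0.
  rewrite fE mul0r addr0 -/c /u.
  have : `|c| ^+ 2 != 0 by rewrite expf_neq0 // normr_eq0.
  rewrite -add_Re2_Im2; case: (c) => a b /=.
  rewrite eq_complex /= eqxx andbT => ab.
  suff : 0 < a ^+ 2 + b ^+ 2 by lra.
  by rewrite lt_neqAle eq_sym ab addr_ge0 ?sqr_ge0.
suff : 0 <= f.[0] by rewrite leNgt f0.
pose nw : R := complex.Re `|w|.
have nwE : `|w| = nw%:C%C by rewrite /nw normc_def.
have nw0 : 0 <= nw by rewrite -ler0c -nwE.
have d0 : 0 < rho / (nw + 1) by rewrite divr_gt0 //; lra.
apply: (horner_ge0_right d0) => s /andP[s0 sd].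
have snw : s * nw < rho.
  move: sd; rewrite ltr_pdivlMr; last by lra.
  by rewrite mulrDr mulr1; lra.
pose z := z0 + s%:C%C * w.
have zz : `|z - z0| < rho%:C%C.
  rewrite /z addrAC subrr add0r normrM nwE ger0_norm ?ler0c ?ltW //.
  by rewrite -rmorphM ltcR.
have := Pmin z zz.
have -> : P.[z] = P.[z0] + D.[z] by rewrite hornerD hornerN hornerC addrC subrK.
rewrite ImD lerDl DE hornerM horner_exp hornerXsubC /z addrAC subrr add0r.
rewrite exprMn wk mulrCA -rmorphXn ImMr pmulr_rge0 ?exprn_gt0 //.
by rewrite fE mulrC.
Qed.

Lemma evalC_continuous P :
  continuous (fun p : R * R => complex.Re (evalC P (p.1 +i* p.2)%C)) /\
  continuous (fun p : R * R => complex.Im (evalC P (p.1 +i* p.2)%C)).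
Proof.
elim/poly_ind: P => [|P c [IHr IHi]].
  have e p : evalC (0 : {poly R}) (p : C) = 0 by rewrite /evalC rmorph0 horner0.
  by split=> p; under eq_fun do rewrite e; exact: cvg_cst.
have ReE (p : R * R) : complex.Re (evalC (P * 'X + c%:P) (p.1 +i* p.2)%C) =
    complex.Re (evalC P (p.1 +i* p.2)%C) * p.1 -
    complex.Im (evalC P (p.1 +i* p.2)%C) * p.2 + c.
  by rewrite evalC_MX; case: (evalC _ _).
have ImE (p : R * R) : complex.Im (evalC (P * 'X + c%:P) (p.1 +i* p.2)%C) =
    complex.Re (evalC P (p.1 +i* p.2)%C) * p.2 +
    complex.Im (evalC P (p.1 +i* p.2)%C) * p.1.
  by rewrite evalC_MX; case: (evalC _ _) => a b /=; rewrite addr0.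
split=> p.
  rewrite (funext ReE).
  apply: cvgD; last exact: cvg_cst.
  by apply: cvgB; apply: cvgM; [exact: IHr|exact: cvg_fst|exact: IHi|exact: cvg_snd].
rewrite (funext ImE).
by apply: cvgD; apply: cvgM; [exact: IHr|exact: cvg_snd|exact: IHi|exact: cvg_fst].
Qed.

Lemma half_disk_compact :
  compact [set p : R * R | p.1 ^+ 2 + p.2 ^+ 2 <= 1 /\ 0 <= p.2].
Proof.
pose A : set (R * R) := `[-1, 1] `*` `[0, 1].
pose B : set (R * R) := (fun p => p.1 ^+ 2 + p.2 ^+ 2) @^-1` [set x | x <= 1].
have -> : [set p : R * R | p.1 ^+ 2 + p.2 ^+ 2 <= 1 /\ 0 <= p.2] = A `&` B.
  apply/seteqP; split=> [[x y] /= [xy y0] | [x y] /= [[]]]; last first.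
    by rewrite /= !in_itv /= => _ /andP[-> _].
  split=> //; rewrite /A /= !in_itv /= y0 -ler_norml.
  have x2 := sqr_ge0 x; have y2 := sqr_ge0 y.
  split; first by rewrite -(expr_le1 (n := 2)) // real_normK ?num_real //; lra.
  by rewrite -(expr_le1 (n := 2)) //; lra.
apply: compact_closedI; first by apply: compact_setX; exact: segment_compact.
apply: closed_comp; last exact: closed_le.
move=> p _; rewrite /continuous_at.
by apply: cvgD; rewrite expr2; apply: cvgM; first [exact: cvg_fst | exact: cvg_snd].
Qed.

(** By compactness the imaginary part has a minimum over the closed half disk. It
    is not attained inside, and the values on the boundary are non-negative: on
    the diameter they vanish, on the arc they are sin t q (cos t). *)
Lemma Im_evalC_gt0 P z : (1 < size P)%N ->
  (forall x, -1 <= x <= 1 -> 0 <= (sin_quotient P).[x]) ->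
  `|z| < 1 -> 0 < complex.Im z -> 0 < complex.Im (evalC P z).
Proof.
move=> sP qge z1 zi.
pose K := [set p : R * R | p.1 ^+ 2 + p.2 ^+ 2 <= 1 /\ 0 <= p.2].
pose F (p : R * R) := complex.Im (evalC P (p.1 +i* p.2)%C).
have no_min a b : a ^+ 2 + b ^+ 2 < 1 -> 0 < b ->
    ~ (forall p, K p -> F (a, b) <= F p).
  move=> ab b0 Fmin; pose h := Num.sqrt (a ^+ 2 + b ^+ 2).
  have h1 : h < 1 by rewrite -[ltRHS]sqrtr1 ltr_sqrt.
  pose rho := Num.min b (1 - h).
  have rho0 : 0 < rho by rewrite lt_min b0 subr_gt0.
  have sPC : (1 < size (map_poly (real_complex R) P))%N by rewrite size_map_poly.
  apply: (Im_poly_no_local_min (z0 := (a +i* b)%C) sPC rho0) => -[x y] xy.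
  have xy1 : `|(x +i* y)%C| < 1.
    have -> : (x +i* y)%C = ((x +i* y)%C - (a +i* b)%C) + (a +i* b)%C by rewrite subrK.
    apply: le_lt_trans (ler_normD _ _) _.
    rewrite (normc_def (a +i* b)%C) /= -/h.
    have hl : `|(x +i* y)%C - (a +i* b)%C| < (1 - h)%:C%C.
      by apply: lt_le_trans xy _; rewrite lecR ge_min lexx orbT.
    by rewrite -ltrBrDr; apply: lt_le_trans hl _; rewrite rmorphB.
  apply: (Fmin (x, y)); split; first by move: xy1; rewrite normC_lt1 => /ltW.
  have : `|y - b| < b.
    rewrite -ltcR; apply: le_lt_trans (lt_le_trans xy _).
      by rewrite normc_def lecR -sqrtr_sqr ler_wsqrtr //= lerDr sqr_ge0.
    by rewrite lecR ge_min lexx.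
  by rewrite ltr_distl subrr => /andP[/ltW].
have [[a b] /set_mem[/= ab b0] Fmin] : exists2 c, c \in K & forall p, p \in K -> F c <= F p.
  apply: compact_EVT_min.
  - by exists (0, 0); split=> //=; rewrite expr0n addr0.
  - exact: half_disk_compact.
  - by apply: continuous_subspaceT; have [] := evalC_continuous P.
have Fge p : K p -> F (a, b) <= F p by move=> Kp; apply: Fmin; apply: mem_set.
have F0 : 0 <= F (a, b).
  have [b00 | bn0] := eqVneq b 0.
    by rewrite /F b00 /= -[(a +i* 0)%C]/(a%:C%C) evalC_real.
  have [ab1 | abn1] := eqVneq (a ^+ 2 + b ^+ 2) 1.
    rewrite /F /= Im_evalC_circle // mulr_ge0 // qge // -ler_norml.
    rewrite -(expr_le1 (n := 2)) // real_normK ?num_real //.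
    by have := sqr_ge0 b; lra.
  exfalso; apply: (no_min a b) => //; rewrite lt_neqAle ?abn1 //.
  by rewrite eq_sym bn0.
case: z z1 zi => x y; rewrite normC_lt1 /= => xy y0.
rewrite ltNge; apply/negP => Fz; apply: (no_min x y) => // p Kp.
exact: le_trans Fz (le_trans F0 (Fge p Kp)).
Qed.

Lemma derivable_horner_field (K : numFieldType) (p : {poly K}) (z : K) :
  derivable (horner p : K^o -> K^o) z 1.
Proof.
elim/poly_ind: p => [|p c IH].
  have -> : horner (0 : {poly K}) = cst 0 by apply/funext => w; rewrite horner0.
  exact: derivable_cst.
pose f : K^o -> K^o := horner p.
have -> : horner (p * 'X + c%:P) = ((f * id) + cst c : K^o -> K^o).
  by apply/funext => w; rewrite !hornerE.
apply: (@derivableD K K^o K^o); last exact: derivable_cst.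
exact: (@derivableM K K^o f id z 1 IH (@derivable_id K K^o z 1)).
Qed.

Lemma typically_real_polyP N P :
  typically_real_poly N P <-> nonneg_sine_poly N P.
Proof.
split; first exact: nonneg_of_typically_real.
move=> [sP P0 P1 qge].
have sP1 : (1 < size P)%N.
  by rewrite ltnNge; apply/negP => s; move/eqP: P1; rewrite nth_default // eq_sym oner_eq0.
split=> //; split.
- by move=> z _; exact: derivable_horner_field.
- by case=> x y _ /= ->; rewrite -[(x +i* 0)%C]/(x%:C%C) evalC_real.
move=> z z1 zi; have [zneg | zpos] := ltP (complex.Im z) 0.
  have := @Im_evalC_gt0 P (conjc z) sP1 qge; rewrite normcJ z1 evalC_conj.
  case: (z) (evalC P z) zneg => [x y] [u v] /= y0 /(_ isT).
  by rewrite !oppr_gt0 => /(_ y0) v0; rewrite nmulr_lgt0.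
have zpos' : 0 < complex.Im z by rewrite lt_neqAle eq_sym zi.
by rewrite mulr_gt0 // Im_evalC_gt0.
Qed.

End ComplexEvaluation.

(** * The closed form *)

Section ClosedForm.
Variable R : realType.
Variable m : nat.
Variable eta : R.
Local Notation C := R[i].
Local Notation chebS := (chebS R).
Local Notation node_poly := (node_poly R m).
Local Notation N := (m.*2).
Implicit Types (x y t : R) (P F : {poly R}) (n k j : nat).

Definition denom_poly : {poly R} :=
  (1 - 'X) * (1 + 'X) ^+ 3 * ('X ^+ 2 + 1 - (2 * eta)%:P * 'X) ^+ 2.

(** The numerator of [P1e]: it equals x ^ 6 times its value at 1 / x. *)
Definition palindromic_poly : {poly R} :=
  'X + 'X ^+ 5 + (gamma1 eta)%:P * ('X ^+ 2 + 'X ^+ 4) + (gamma2 N eta)%:P * 'X ^+ 3.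

Definition tail_poly : {poly R} :=
  (((N%:R + 4) / 2) ^+ 2)%:P * (1 - 'X ^+ (N + 2))
  + (((N%:R + 2) / 2) ^+ 2)%:P * (1 - 'X ^+ (N + 4))
  + ((N%:R + 2) * (N%:R + 4) / 2)%:P * ('X - 'X ^+ (N + 3)).

Definition numer_poly : {poly R} :=
  palindromic_poly * ((1 - 'X) * (1 + 'X)) + (8 * Q_ N eta)%:P * 'X ^+ 4 * tail_poly.

Let N2m : N%:R = 2 * m%:R :> R.
Proof. by rewrite -muln2 natrM mulrC. Qed.

Lemma poly_eq0_of_horner (p : {poly R}) : (forall x, x != 0 -> p.[x] = 0) -> p = 0.
Proof.
move=> p0; apply: (@roots_geq_poly_eq0 _ p [seq i.+1%:R | i <- iota 0 (size p)]).
- by apply/allP => x /mapP[i _ ->]; rewrite rootE p0 // pnatr_eq0.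
- rewrite map_inj_uniq ?iota_uniq // => i j /eqP.
  by rewrite eqr_nat => /eqP[].
- by rewrite size_map size_iota.
Qed.

(** The substitution x -> 1 / x, read on coefficients. *)
Lemma coef_of_inversion n F : (size F <= n + 9)%N ->
  (forall x, x != 0 -> F.[x] + x ^+ 8 * F.[x^-1] = 0) ->
  (forall j, (8 < j)%N -> F`_j = 0) /\ (forall j, (j <= 8)%N -> F`_j = - F`_(8 - j)).
Proof.
move=> sF Finv.
pose W := 'X^n * F + \poly_(i < n + 9) F`_(n + 8 - i).
have revE x : x != 0 -> (\poly_(i < n + 9) F`_(n + 8 - i)).[x] = x ^+ (n + 8) * F.[x^-1].
  move=> x0; rewrite horner_poly (horner_coef_wide _ sF) mulr_sumr.
  rewrite (reindex_inj rev_ord_inj) /=; apply: eq_bigr => i _.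
  have i9 : (i <= n + 8)%N by rewrite -ltnS -addnS.
  have -> : (n + 8 - (n + 9 - i.+1) = i)%N by lia.
  have -> : (n + 9 - i.+1 = n + 8 - i)%N by lia.
  by rewrite mulrCA exprVn -expfB_cond // (negPf x0) add0n.
have W0 : W = 0.
  apply: poly_eq0_of_horner => x x0; rewrite hornerD hornerM hornerXn revE //.
  by rewrite exprD -mulrA -mulrDr Finv // mulr0.
have cW k : (if (k < n)%N then 0 else F`_(k - n))
    + (if (k < n + 9)%N then F`_(n + 8 - k) else 0) = 0.
  by have := congr1 (fun p : {poly R} => p`_k) W0; rewrite coefD coefXnM coef_poly coef0.
split=> j j8.
  have [jn | jn] := leqP (n + 9) j; first by rewrite nth_default // (leq_trans sF).
  have := cW (n + 8 - j)%N; rewrite ifT; last by lia.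
  by rewrite ifT ?add0r ?subKn //; lia.
have := cW (n + 8 - j)%N; rewrite ifF; last by lia.
rewrite ifT; last by lia.
have -> : (n + 8 - j - n = 8 - j)%N by lia.
have -> : (n + 8 - (n + 8 - j) = j)%N by lia.
by move/eqP; rewrite addrC addr_eq0 => /eqP.
Qed.

Variable P : {poly R}.
Hypotheses (sP : (size P <= N.+1)%N) (P0 : P`_0 = 0) (P1 : P`_1 = 1).
Hypotheses (P2 : P`_2 = 2 * eta) (Pext : extremal_quotient m eta P).

Let horner_joukowski x : x != 0 ->
  P.[x] - P.[x^-1] = (x - x^-1) * (sin_quotient P).[(x + x^-1) / 2].
Proof.
move=> x0; rewrite !(horner_coef P) -sumrB (horner_sin_quotient _ (leqnn _)) mulr_sumr.
apply: eq_bigr => j _; rewrite mulrCA [(x - _) * _]mulrC chebS_joukowski //.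
by rewrite mulrBr exprVn.
Qed.

Let denom_poly_joukowski x : x != 0 -> denom_poly.[x] =
  - 8 * x ^+ 4 * ((x - x^-1) * (((x + x^-1) / 2 + 1) * ((x + x^-1) / 2 - eta) ^+ 2)).
Proof. by move=> x0; rewrite /denom_poly !(hornerE, horner_exp) /=; field. Qed.

(** At (x + 1 / x) / 2 the defining identity of the extremal quotient, multiplied
    by (x - 1 / x) ^ 2, becomes a Laurent polynomial identity; the palindromic part
    of the numerator cancels on the right. *)
Let sym_equation x : x != 0 ->
  denom_poly.[x] * (P.[x] - P.[x^-1]) = numer_poly.[x] + x ^+ 8 * numer_poly.[x^-1].
Proof.
move=> x0; rewrite horner_joukowski // denom_poly_joukowski //.
set u := (x + x^-1) / 2.
have Gu : node_poly.[u] * (x - x^-1) =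
    m.+2%:R * (x ^+ m.+1 - x ^- m.+1) + m.+1%:R * (x ^+ m.+2 - x ^- m.+2).
  by rewrite horner_node_poly mulrDl -!mulrA !chebS_joukowski.
have qu : (sin_quotient P).[u] * ((u + 1) * (u - eta) ^+ 2) = Q_ N eta * node_poly.[u] ^+ 2.
  have := congr1 (horner^~ u) Pext.
  by rewrite hornerM hornerZ !horner_exp hornerM hornerD hornerX hornerC horner_exp hornerXsubC.
transitivity (- 8 * x ^+ 4 * Q_ N eta * (node_poly.[u] * (x - x^-1)) ^+ 2).
  rewrite exprMn; transitivity (- 8 * x ^+ 4 * (x - x^-1) ^+ 2 *
    ((sin_quotient P).[u] * ((u + 1) * (u - eta) ^+ 2))); first by ring.
  by rewrite qu; ring.
have h1 y : (1 : {poly R}).[y] = 1 by rewrite -[1]/(1%:P) hornerC.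
have hE := (hornerD, hornerN, hornerM, horner_exp, hornerX, hornerC, h1).
rewrite Gu /numer_poly /palindromic_poly /tail_poly !hE N2m.
rewrite -[m.+2%:R]natr1 -[m.+1%:R]natr1.
have xN k : x ^+ (N + k) = x ^+ m * x ^+ m * x ^+ k by rewrite exprD -addnn exprD.
have xNV k : x^-1 ^+ (N + k) = (x ^+ m)^-1 * (x ^+ m)^-1 * x^-1 ^+ k.
  by rewrite exprD -addnn exprD exprVn.
rewrite !xN !xNV.
rewrite [x ^+ m.+2]exprS [x ^+ m.+1]exprS.
have xm0 : x ^+ m != 0 by rewrite expf_neq0.
move: (x ^+ m) xm0 (gamma1 eta) (gamma2 N eta) (Q_ N eta) (m%:R) => p p0 c1 c2 Q M.
by field; rewrite x0 p0.
Qed.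

Let sizeM (p q : {poly R}) a b : (size p <= a.+1)%N -> (size q <= b.+1)%N ->
  (size (p * q)%R <= (a + b).+1)%N.
Proof. by move=> ha hb; have := size_polyMleq p q; move: ha hb; lia. Qed.

Let sizeD (p q : {poly R}) a : (size p <= a)%N -> (size q <= a)%N ->
  (size (p + q)%R <= a)%N.
Proof. by move=> ha hb; rewrite (leq_trans (size_polyD _ _)) // geq_max ha. Qed.

Let sizeN (p : {poly R}) a : (size p <= a)%N -> (size (- p)%R <= a)%N.
Proof. by rewrite size_polyN. Qed.

Let sizeXn k a : (k <= a)%N -> (size ('X ^+ k : {poly R})%R <= a.+1)%N.
Proof. by rewrite size_polyXn. Qed.

Let sizeX a : (0 < a)%N -> (size ('X : {poly R}) <= a.+1)%N.
Proof. by rewrite size_polyX. Qed.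

Let sizeC c a : (size (c%:P : {poly R}) <= a.+1)%N.
Proof. by rewrite (leq_trans (size_polyC_leq1 _)). Qed.

Let size1 a : (size (1 : {poly R})%R <= a.+1)%N.
Proof. by rewrite size_poly1. Qed.

Let size_denom_poly : (size denom_poly <= 9)%N.
Proof.
rewrite /denom_poly [_ ^+ 3]exprS !expr2.
have h1 : (size (1 + 'X : {poly R})%R <= 2)%N by apply: sizeD; [exact: size1|exact: sizeX].
have h2 : (size (1 - 'X : {poly R})%R <= 2)%N.
  by apply: sizeD; [exact: size1|apply: sizeN; exact: sizeX].
have h3 : (size ('X * 'X + 1 - (2 * eta)%:P * 'X : {poly R})%R <= 3)%N.
  apply: sizeD; first by apply: sizeD; [rewrite -expr2; exact: sizeXn|exact: size1].
  by apply: sizeN; apply: (@sizeM _ _ 0 2); [exact: sizeC|exact: sizeX].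
apply: (@sizeM _ _ 4 4); last exact: (@sizeM _ _ 2 2).
apply: (@sizeM _ _ 1 3) => //; apply: (@sizeM _ _ 1 2) => //; exact: (@sizeM _ _ 1 1).
Qed.

Let size_numer_poly : (size numer_poly <= N + 9)%N.
Proof.
rewrite addnS; apply: sizeD.
  have h : (7 <= N + 8)%N by lia.
  apply: leq_trans (_ : 8 <= _)%N => //; apply: (@sizeM _ _ 5 2).
    apply: sizeD; last by apply: (@sizeM _ _ 0 5); [exact: sizeC|exact: sizeXn].
    apply: sizeD; first by apply: sizeD; [exact: sizeX|exact: sizeXn].
    by apply: (@sizeM _ _ 0 5); [exact: sizeC|apply: sizeD; exact: sizeXn].
  by apply: (@sizeM _ _ 1 1); apply: sizeD; rewrite ?size1 ?sizeN ?sizeX.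
have -> : (N + 8 = 4 + (N + 4))%N by lia.
apply: (@sizeM _ _ 4 (N + 4)).
  by apply: (@sizeM _ _ 0 4); [exact: sizeC|exact: sizeXn].
have le2 : (N + 2 <= N + 4)%N by rewrite leq_add2l.
have le3 : (N + 3 <= N + 4)%N by rewrite leq_add2l.
have le1 : (0 < N + 4)%N by rewrite addn4.
apply: sizeD; first apply: sizeD.
- apply: (@sizeM _ _ 0 (N + 4)); first exact: sizeC.
  by apply: sizeD; [exact: size1|apply: sizeN; exact: sizeXn].
- apply: (@sizeM _ _ 0 (N + 4)); first exact: sizeC.
  by apply: sizeD; [exact: size1|apply: sizeN; exact: sizeXn].
apply: (@sizeM _ _ 0 (N + 4)); first exact: sizeC.
by apply: sizeD; [exact: sizeX|apply: sizeN; exact: sizeXn].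
Qed.

Let F := denom_poly * P - numer_poly.

(** Below X ^ 3 the product involves only the first three coefficients of P, and
    the coefficient of X ^ 2 agrees by the value of [gamma1]. *)
Let F_low j : (j < 3)%N -> F`_j = 0.
Proof.
move=> j3.
have PE : P = 'X + (2 * eta)%:P * 'X ^+ 2 + drop_poly 3 P * 'X ^+ 3.
  rewrite -{1}(poly_take_drop 3 P); congr (_ + _).
  rewrite /take_poly poly_def !big_ord_recl big_ord0 /= P0 P1 P2.
  by rewrite scale0r add0r scale1r addr0 expr1 mul_polyC.
move: (drop_poly 3 P) PE => P3 PE.
(* f and e are the tails of the two factors of the denominator, D2 the one of
   their product. *)
pose f : {poly R} := (2 + 4 * eta ^+ 2)%:P - (4 * eta)%:P * 'X + 'X ^+ 2.
pose e : {poly R} := - 2%:P - 'X.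
pose D2 : {poly R} := - (8 * eta)%:P + f + 2%:P * 'X * f
  + 'X * e * (1 - (4 * eta)%:P * 'X + 'X ^+ 2 * f).
have DE : denom_poly = 1 + (2 - 4 * eta)%:P * 'X + 'X ^+ 2 * D2.
  by rewrite /denom_poly /D2 /f /e; ring.
pose T3 : {poly R} := (gamma2 N eta)%:P + (gamma1 eta)%:P * 'X + 'X ^+ 2
  - (1 + 'X ^+ 4 + (gamma1 eta)%:P * ('X + 'X ^+ 3) + (gamma2 N eta)%:P * 'X ^+ 2)
  + (8 * Q_ N eta)%:P * 'X * tail_poly.
have TE : numer_poly = 'X + (gamma1 eta)%:P * 'X ^+ 2 + 'X ^+ 3 * T3.
  by rewrite /numer_poly /palindromic_poly /T3; move: tail_poly => T; ring.
clearbody T3 D2; have -> : F = 'X^3 * ((2 * eta)%:P * ((2 - 4 * eta)%:P + 'X * D2) + D2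
    + denom_poly * P3 - T3).
  by rewrite /F TE {1}PE DE /gamma1; ring.
by rewrite coefXnM j3.
Qed.

(** The symmetry leaves F = c (X ^ 3 - X ^ 5), whose derivative at -1 is - 2 c. *)
Lemma denom_poly_mul_extremal : denom_poly * P = numer_poly.
Proof.
have sF : (size F <= N + 9)%N.
  apply: sizeD; last by apply: sizeN; exact: size_numer_poly.
  by have := size_polyMleq denom_poly P; move: size_denom_poly sP; lia.
have Finv x : x != 0 -> F.[x] + x ^+ 8 * F.[x^-1] = 0.
  move=> x0; have := sym_equation x0.
  have DV : x ^+ 8 * denom_poly.[x^-1] = - denom_poly.[x].
    by rewrite !(hornerE, horner_exp) /=; field.
  move=> E; rewrite /F !(hornerD (denom_poly * P)) !hornerN !(hornerM denom_poly P).
  have -> : denom_poly.[x] * P.[x] - numer_poly.[x] +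
    x ^+ 8 * (denom_poly.[x^-1] * P.[x^-1] - numer_poly.[x^-1])
    = denom_poly.[x] * P.[x] + (x ^+ 8 * denom_poly.[x^-1]) * P.[x^-1]
      - (numer_poly.[x] + x ^+ 8 * numer_poly.[x^-1]) by ring.
  by rewrite DV -E; ring.
have [Fhigh Fsym] := coef_of_inversion sF Finv.
have F4 : F`_4 = 0 by have /= := Fsym 4%N isT; lra.
have FE : F = (F`_3)%:P * ('X ^+ 3 - 'X ^+ 5).
  apply/polyP => j; rewrite mul_polyC coefZ (coefB 'X^3) !coefXn.
  have [j8 | j8] := ltnP 8 j.
    by rewrite Fhigh // !gtn_eqF ?subrr ?mulr0 // (leq_trans _ j8).
  case: j j8 => [|[|[|[|[|[|[|[|[|//]]]]]]]]] _ /=;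
    rewrite ?subrr ?mulr0 ?subr0 ?mulr1 ?sub0r ?mulrN1 //.
  - exact: F_low.
  - exact: F_low.
  - exact: F_low.
  - by rewrite Fsym.
  - by rewrite Fsym // F_low ?oppr0.
  - by rewrite Fsym // F_low ?oppr0.
  - by rewrite Fsym // F_low ?oppr0.
(* The denominator has a multiple zero at -1, and so has the numerator thanks to
   the value of [gamma2]; this fixes the one coefficient left. *)
have dF : (F^`()).[-1] = 0.
  have dDP : ((denom_poly * P)^`()).[-1] = 0.
    rewrite (_ : denom_poly * P = (1 + 'X) * ((1 + 'X) *
      ((1 - 'X) * (1 + 'X) * ('X ^+ 2 + 1 - (2 * eta)%:P * 'X) ^+ 2 * P))); last first.
      by rewrite /denom_poly; ring.
    move: (_ * P) => W; rewrite !derivM derivD derivX derivC.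
    by rewrite !(hornerE, horner_exp) /=; ring.
  have dN : (numer_poly^`()).[-1] = 0.
    have N0 : (-1) ^+ N = 1 :> R by rewrite -signr_odd odd_double.
    have tail0 : tail_poly.[-1] = 0.
      by rewrite !(hornerE, horner_exp) /= !exprD N0; ring.
    have dtail : (tail_poly^`()).[-1] = 2 * (m%:R + 1) * (m%:R + 2).
      have e2 : (-1) ^+ (N + 2).-1 = -1 :> R by rewrite addn2 exprS N0 mulr1.
      have e3 : (-1) ^+ (N + 3).-1 = 1 :> R by rewrite addn3 !exprS N0; ring.
      have e4 : (-1) ^+ (N + 4).-1 = -1 :> R by rewrite addn4 !exprS N0; ring.
      rewrite /tail_poly !poly.derivE !(hornerD, hornerM, hornerN, hornerC, hornerMn, hornerXn).
      rewrite e2 e3 e4 !mulNrn (natrD _ N 2) (natrD _ N 3) (natrD _ N 4) N2m.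
      by field.
    have derivM_at (p q : {poly R}) x :
        ((p * q)^`()).[x] = (p^`()).[x] * q.[x] + p.[x] * (q^`()).[x].
      by rewrite derivM hornerD !hornerM.
    pose W : {poly R} := (1 - 'X) * (1 + 'X).
    have W0 : W.[-1] = 0 by rewrite !hornerE /=; ring.
    have dW : (W^`()).[-1] = 2.
      by rewrite /W derivM_at !poly.derivE !hornerE /=; ring.
    have pal : palindromic_poly.[-1] = - 2 + 2 * gamma1 eta - gamma2 N eta.
      by rewrite /palindromic_poly; move: (gamma1 _) (gamma2 _ _) => c1 c2;
        rewrite !(hornerE, horner_exp) /=; ring.
    have c4 : ((8 * Q_ N eta)%:P * 'X ^+ 4).[-1] = 8 * Q_ N eta.
      by rewrite hornerM hornerC horner_exp hornerX; ring.
    rewrite /numer_poly derivD hornerD (derivM_at palindromic_poly) -/W W0 dW.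
    rewrite (derivM_at (_ * _) tail_poly) tail0 dtail pal c4 !mulr0 !add0r.
    have M0 := ler0n R m.
    have [h1 h2 h3] : [/\ m%:R + 1 != 0 :> R, m%:R + 2 != 0 :> R & 2 * m%:R + 3 != 0 :> R].
      by split; rewrite gt_eqF //; lra.
    by rewrite Q_E /gamma1 /gamma2 N2m; field; rewrite h1 h2 h3.
  by rewrite derivB hornerD hornerN dDP dN subrr.
have F3 : F`_3 = 0.
  move: dF; rewrite {1}FE; move: (F`_3) => c.
  rewrite derivM derivC mul0r add0r derivB !derivXn.
  rewrite hornerM hornerC hornerD hornerN !hornerMn !hornerXn /=; lra.
by apply/eqP; rewrite -subr_eq0 -/F FE F3 mul0r.
Qed.

End ClosedForm.

(** * Extremizers and their two forms *)

Lemma cvg_removable (T U : topologicalType) (f g : T -> U) (x : T) :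
  {for x, continuous f} -> (\forall y \near x^', f y = g y) ->
  g y @[y --> x^'] --> f x.
Proof.
move=> fx fg; apply: cvg_trans (near_eq_cvg fg) _.
by apply: cvg_trans fx; apply: cvg_app; apply: nbhs_dnbhs.
Qed.

Section Main.
Variable R : realType.
Variable m : nat.
Hypothesis m0 : (0 < m)%N.
Local Notation C := R[i].
Local Notation N := (m.*2).
Implicit Types (x t : R) (z : C) (P S : {poly R}).

Lemma maximizes_a2P (eta : R) P : largest_node m eta ->
  maximizes_a2 N P <-> nonneg_sine_poly N P /\ P`_2 = 2 * eta.
Proof.
move=> emax; split=> [[/typically_real_polyP Pge Pmax] | [Pge P2]].
  split=> //; apply/eqP; rewrite eq_le (coef2_le m0 emax Pge).
  have [S Sge <-] := extremal_exists m0 emax.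
  by apply: Pmax; apply/typically_real_polyP.
split; first exact/typically_real_polyP.
by move=> S /typically_real_polyP Sge; rewrite P2 (coef2_le m0 emax Sge).
Qed.

Lemma maximizes_a2_unique (eta : R) P S : largest_node m eta ->
  maximizes_a2 N P -> maximizes_a2 N S -> P = S.
Proof.
move=> emax /(maximizes_a2P _ emax)[Pge P2] /(maximizes_a2P _ emax)[Sge S2].
have [_ P0 _ _] := Pge; have [_ S0 _ _] := Sge.
by apply: (extremal_unique P0 S0); apply: (extremal_of_coef2 m0 emax).
Qed.

Lemma coef_flip_even P j : (flip_even P)`_j = (-1) ^+ j.+1 * P`_j.
Proof.
rewrite /flip_even coef_poly; case: ltnP => [_|jP]; last by rewrite nth_default ?mulr0.
by rewrite -signr_odd /=; case: (odd j); rewrite ?mul1r // expr1 mulN1r.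
Qed.

Lemma flip_evenK : involutive (@flip_even R).
Proof.
move=> P; apply/polyP => j.
by rewrite !coef_flip_even mulrA -expr2 sqrr_sign mul1r.
Qed.

(** Flipping the even coefficients is x -> - x on the sine quotient. *)
Lemma nonneg_sine_poly_flip k P :
  nonneg_sine_poly k P -> nonneg_sine_poly k (flip_even P).
Proof.
move=> [sP P0 P1 Pge].
have sF : (size (flip_even P) <= size P)%N by apply: size_poly.
split.
- exact: leq_trans sF sP.
- by rewrite coef_flip_even P0 mulr0.
- by rewrite coef_flip_even P1; ring.
move=> x /andP[xN1 x1].
have -> : (sin_quotient (flip_even P)).[x] = (sin_quotient P).[- x].
  rewrite (horner_sin_quotient _ sF) (horner_sin_quotient _ (leqnn _)).
  by apply: eq_bigr => j _; rewrite coef_flip_even chebS_opp; ring.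
by apply: Pge; rewrite lerNl opprK x1 lerNl xN1.
Qed.

Lemma minimizes_a2_flip P : minimizes_a2 N P <-> maximizes_a2 N (flip_even P).
Proof.
have typ_flip S : typically_real_poly N S -> typically_real_poly N (flip_even S).
  by move=> /typically_real_polyP/nonneg_sine_poly_flip/typically_real_polyP.
have flip2 S : (flip_even S)`_2 = - S`_2 by rewrite coef_flip_even; ring.
split=> [[Ptyp Pmin] | [Ptyp Pmax]]; split.
- exact: typ_flip.
- by move=> S /typ_flip /Pmin; rewrite !flip2; lra.
- by rewrite -[P]flip_evenK; exact: typ_flip.
- by move=> S /typ_flip /Pmax; rewrite !flip2; lra.
Qed.

Lemma evalC_denom_poly (eta : R) z : evalC (denom_poly eta) z =
  (1 - z) * (1 + z) ^+ 3 * (z ^+ 2 + 1 - 2 * eta%:C%C * z) ^+ 2.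
Proof.
have h1 : (1 : {poly C}).[z] = 1 by rewrite -[1]/(1%:P) hornerC.
rewrite /evalC /denom_poly !(rmorphM, rmorphXn, rmorphD, rmorphN, rmorph1) /=.
rewrite !(map_polyX, map_polyC) /=.
by rewrite !(hornerM, horner_exp, hornerD, hornerN, hornerX, hornerC, h1) ?rmorph_nat.
Qed.

Lemma evalC_numer_poly (eta : R) z : evalC (numer_poly m eta) z =
  (z + z ^+ 5 + (gamma1 eta)%:C%C * (z ^+ 2 + z ^+ 4)
     + (gamma2 N eta)%:C%C * z ^+ 3) * ((1 - z) * (1 + z)) +
  8 * (Q_ N eta)%:C%C * z ^+ 4 *
  (((N%:R + 4) / 2) ^+ 2 * (1 - z ^+ (N + 2))
     + ((N%:R + 2) / 2) ^+ 2 * (1 - z ^+ (N + 4))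
     + (N%:R + 2) * (N%:R + 4) / 2 * (z - z ^+ (N + 3))).
Proof.
have h1 : (1 : {poly C}).[z] = 1 by rewrite -[1]/(1%:P) hornerC.
have toC := (rmorphXn, rmorphM, rmorphD, fmorphV, rmorph_nat).
pose A : R := ((N%:R + 4) / 2) ^+ 2; pose B : R := ((N%:R + 2) / 2) ^+ 2.
pose D : R := (N%:R + 2) * (N%:R + 4) / 2; pose Q : R := 8 * Q_ N eta.
have AE : ((N%:R + 4) / 2) ^+ 2 = A%:C%C by rewrite /A !toC.
have BE : ((N%:R + 2) / 2) ^+ 2 = B%:C%C by rewrite /B !toC.
have DE : (N%:R + 2) * (N%:R + 4) / 2 = D%:C%C by rewrite /D !toC.
have QE : 8 * (Q_ N eta)%:C%C = Q%:C%C by rewrite /Q [in RHS]rmorphM rmorph_nat.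
rewrite AE BE DE QE /evalC /numer_poly /palindromic_poly /tail_poly -/A -/B -/D -/Q.
move: A B D Q (gamma1 eta) (gamma2 N eta) {AE BE DE QE} => A B D Q c1 c2.
rewrite !(rmorphM, rmorphXn, rmorphD, rmorphN, rmorph1) /= !(map_polyX, map_polyC) /=.
by rewrite !(hornerM, horner_exp, hornerD, hornerN, hornerX, hornerC, h1).
Qed.

Variable eta : R.
Hypothesis emax : largest_node m eta.
Variable P : {poly R}.
Hypothesis Pmax : maximizes_a2 N P.

Let Pspec : nonneg_sine_poly N P /\ P`_2 = 2 * eta.
Proof. exact/maximizes_a2P. Qed.

Let Pext : extremal_quotient m eta P.
Proof. by have [Pge P2] := Pspec; apply: (extremal_of_coef2 m0 emax). Qed.

Lemma evalC_closed_form z : ~ sing_z eta z ->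
  evalC P z = P1e N eta z + P2e N eta z.
Proof.
have [[sP P0 P1 _] P2] := Pspec.
move=> /= /eqP; rewrite !mulf_eq0 !negb_or => /andP[/andP[z1 z2] z3].
have := congr1 (fun p => evalC p z) (denom_poly_mul_extremal sP P0 P1 P2 Pext).
rewrite {1}/evalC rmorphM hornerM -!/(evalC _ _) evalC_denom_poly evalC_numer_poly.
rewrite /P1e /P2e; move: (z ^+ 2 + 1 - _) z3 => w w0.
move: (_ + _ * (z - z ^+ (N + 3))) => T.
move: (evalC P z) (Q_ N eta)%:C%C (gamma1 eta)%:C%C (gamma2 N eta)%:C%C => p Q c1 c2 E.
have D0 : (1 - z) * (1 + z) ^+ 3 * w ^+ 2 != 0 by rewrite !mulf_neq0 ?expf_neq0.
apply: (mulfI D0); rewrite E.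
by field; rewrite z1 z2 w0.
Qed.

Lemma near_root_free (K : numFieldType) (p : {poly K}) (x : K) : p != 0 ->
  \forall y \near (x : K^o)^', p.[y] != 0.
Proof.
move=> p0; have [k [q]] := multiplicity_XsubC p x; rewrite p0 /= => qx pE.
have qc : {for (x : K^o), continuous (horner q : K^o -> K^o)}.
  by apply/differentiable_continuous/derivable1_diffP/derivable_horner_field.
have qnear : \forall y \near (x : K^o), q.[y] != 0 by apply: (cvgr_neq0 _ qc).
apply: filterS2 (nbhs_dnbhs_neq (x : K^o)) (nbhs_dnbhs qnear) => y yx qy.
by rewrite pE hornerM horner_exp hornerXsubC mulf_neq0 // expf_neq0 // subr_eq0.
Qed.

Lemma eq_after_removal_z :
  eq_after_removal setT (sing_z eta) (evalC P) (fun z => P1e N eta z + P2e N eta z).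
Proof.
split=> [z _ zs | z _ _]; first exact: evalC_closed_form.
pose p : {poly C} := (1 - 'X) * (1 + 'X) * ('X ^+ 2 + 1 - (2 * eta%:C%C)%:P * 'X).
have pE w : p.[w] = (1 - w) * (1 + w) * (w ^+ 2 + 1 - 2 * eta%:C%C * w).
  have h1 : (1 : {poly C}).[w] = 1 by rewrite -[1]/(1%:P) hornerC.
  by rewrite !(hornerM, horner_exp, hornerD, hornerN, hornerX, hornerC, h1).
have p0 : p != 0.
  apply/eqP => p0; have := pE 0.
  rewrite p0 horner0 expr0n /= !(mulr0, subr0, addr0, add0r, mulr1) => /esym/eqP.
  by rewrite oner_eq0.
apply: (@cvg_removable C^o C^o (evalC P)).
  by apply/differentiable_continuous/derivable1_diffP/derivable_horner_field.
apply: filterS (near_root_free z p0) => w pw.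
by apply: evalC_closed_form => ws; move: pw; rewrite pE ws eqxx.
Qed.

Lemma Im_expi t : complex.Im (evalC P (expi t)) = sin t * (sin_quotient P).[cos t].
Proof. by rewrite /expi Im_evalC_circle // cos2Dsin2. Qed.

Lemma Im_expi_ge0 t : 0 < t < pi -> 0 <= complex.Im (evalC P (expi t)).
Proof.
move=> tpi; have [[_ _ _ Pge] _] := Pspec.
rewrite Im_expi; apply: mulr_ge0; first exact: ltW (sin_gt0_pi tpi).
by rewrite Pge // cos_geN1 cos_le1.
Qed.

Lemma trig_closed_form t : 0 < t < pi -> cos t != eta ->
  complex.Im (evalC P (expi t)) = trig_rhs N eta t.
Proof.
move=> tpi te; have st := sin_gt0_pi tpi.
have c1 : 1 + cos t != 0.
  have : 0 < 1 - cos t ^+ 2 by rewrite -sin2cos2 exprn_gt0.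
  have -> : 1 - cos t ^+ 2 = (1 - cos t) * (1 + cos t) by ring.
  by move=> h; apply/eqP => c0; rewrite c0 mulr0 ltxx in h.
have N2m : N%:R = 2 * m%:R :> R by rewrite -muln2 natrM mulrC.
rewrite Im_expi /trig_rhs N2m.
have -> : (2 * m%:R + 2) / 2 * t = m.+1%:R * t by rewrite -[m.+1%:R]natr1; field.
have -> : (2 * m%:R + 4) / 2 * t = m.+2%:R * t.
  by rewrite -[m.+2%:R]natr1 -[m.+1%:R]natr1; field.
rewrite -!chebS_cos.
have -> : (2 * m%:R + 4) / 2 * (sin t * (chebS R m.+1).[cos t]) +
    (2 * m%:R + 2) / 2 * (sin t * (chebS R m.+2).[cos t]) = sin t * (node_poly R m).[cos t].
  by rewrite horner_node_poly -[m.+2%:R]natr1 -[m.+1%:R]natr1; field.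
have := congr1 (horner^~ (cos t)) Pext.
rewrite hornerM hornerZ !horner_exp hornerM hornerD hornerX hornerC horner_exp hornerXsubC.
have s0 : sin t != 0 by rewrite gt_eqF.
have e0 : cos t - eta != 0 by rewrite subr_eq0.
move: (sin_quotient P).[cos t] (node_poly R m).[cos t] (Q_ N eta) => q g Q E.
have c1' : cos t + 1 != 0 by rewrite addrC.
have D0 : (cos t + 1) * (cos t - eta) ^+ 2 != 0.
  by rewrite mulf_neq0 // expf_neq0.
have -> : q = Q * g ^+ 2 / ((cos t + 1) * (cos t - eta) ^+ 2) by rewrite -E mulfK.
by field; rewrite s0 e0 c1.
Qed.

Lemma eq_after_removal_t : eq_after_removal [set t | 0 < t < pi] (sing_t eta)
  (fun t => complex.Im (evalC P (expi t))) (trig_rhs N eta).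
Proof.
split=> [t /= tpi /eqP te | t /= tpi te]; first exact: trig_closed_form.
apply: (@cvg_removable R^o R^o (fun y => complex.Im (evalC P (expi y)))).
  rewrite (funext Im_expi); apply: cvgM; first exact: continuous_sin.
  apply: (@cvg_comp _ _ _ cos (horner (sin_quotient P))); first exact: continuous_cos.
  exact: continuous_horner.
have /andP[t0 t1] := tpi.
have near_t : \forall y \near t, 0 < y < pi.
  by near=> y; apply/andP; split; near: y; [exact: lt_nbhsr|exact: lt_nbhsl].
apply: filterS2 (nbhs_dnbhs_neq t) (nbhs_dnbhs near_t) => y yt /andP[y0 y1].
apply: trig_closed_form; first by rewrite y0.
apply: contra yt => /eqP; rewrite -te => /cos_inj -> //; rewrite in_itv /= !ltW //.
Unshelve. all: by end_near. Qed.

End Main.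

Unset Implicit Arguments.

Theorem theorem5p2 (R : realType) (N : nat) (hN : (2 <= N)%N) (hev : ~~ odd N) :
  (exists nu : R, is_nu N nu) /\
  (exists! P : {poly R}, maximizes_a2 N P) /\
  (forall (nu : R) (P : {poly R}), is_nu N nu -> maximizes_a2 N P ->
    let eta := eta_ nu in
    [/\ eq_after_removal setT (sing_z eta)
          (evalC P) (fun z => P1e N eta z + P2e N eta z),
        (forall S : {poly R}, minimizes_a2 N S <-> S = flip_even P),
        (forall t : R, 0 < t < pi -> 0 <= complex.Im (evalC P (expi t))) &
        eq_after_removal [set t | 0 < t < pi] (sing_t eta)
          (fun t => complex.Im (evalC P (expi t))) (trig_rhs N eta)]).
Proof.
have [m [m0 ->]] : exists m, (0 < m)%N /\ N = m.*2.
  exists N./2; split; first by rewrite half_gt0.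
  by rewrite even_halfK.
split; first exact: is_nu_exists.
split.
  have [eta emax] := largest_node_exists R m0.
  have [P Pge P2] := extremal_exists m0 emax.
  have Pmax : maximizes_a2 m.*2 P by apply/(maximizes_a2P m0 _ emax).
  by exists P; split=> // S; apply: maximizes_a2_unique emax Pmax.
move=> nu P hnu Pmax eta; have emax := is_nu_largest_node m0 hnu.
split.
- exact: eq_after_removal_z.
- move=> S; rewrite minimizes_a2_flip; split=> [Smax | ->]; last by rewrite flip_evenK.
  by rewrite -[S]flip_evenK (maximizes_a2_unique m0 emax Smax Pmax).
- exact: Im_expi_ge0 m0 _ emax _ Pmax.
- exact: eq_after_removal_t.
Qed.
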